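(* Assume that $r\geq 3$, $m\geq 2$ and $1\leq t\leq m$. For $c\ge 1$ let $$\mathbb{S}^m_t(c)=\{x=(x_1,\dots,x_{m+2})\in\mathbb{S}^{m+1}_t: x_{m+2}=\sqrt{1-(1/c)}\}$$ be a small pseudo-hypersphere in $\mathbb{S}^{m+1}_t\subset\mathbb{R}^{m+2}_t$. Then $\mathbb{S}^m_t(c)$ is proper $r$-harmonic (as a hypersurface of $\mathbb{S}^{m+1}_t$) if and only if $c=r$.
   Context: $\mathbb{R}^n_t$ is $\mathbb{R}^n$ with $\langle x,y\rangle=-\sum_{i=1}^t x_iy_i+\sum_{i=t+1}^n x_iy_i$. $\mathbb{S}^n_t(c)=\{x\in\mathbb{R}^{n+1}_t:\langle x,x\rangle=1/c\}$ for $c>0$, with the induced metric (index $t$, constant sectional curvature $c$), and $\mathbb{S}^n_t=\mathbb{S}^n_t(1)$. All manifolds are connected (a connected component is chosen if necessary). The curvature convention on $\mathbb{S}^{n}_t(c)$ is $R(X,Y)Z=c(\langle Y,Z\rangle X-\langle X,Z\rangle Y)$. Hypersurfaces. For a hypersurface $\varphi:M\to N$ with nondegenerate induced metric, unit normal $\eta$, $\varepsilon=\langle\eta,\eta\rangle=\pm1$ and shape operator $A(X)=-\nabla^N_X\eta$, the mean curvature function is $f=\frac1m\varepsilon\operatorname{Tr}A$; the hypersurface is minimal if $f\equiv0$. $r$-harmonicity. Let $\{e_i\}$ be a local orthonormal frame of $M$ with $\langle e_i,e_j\rangle=\varepsilon_i\delta_{ij}$. For a smooth map $\varphi:M\to N$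 of pseudo-Riemannian manifolds, $\tau(\varphi)=\sum_i\varepsilon_i[\nabla^\varphi_{e_i}d\varphi(e_i)-d\varphi(\nabla^M_{e_i}e_i)]$ and $\overline\Delta=-\sum_i\varepsilon_i(\nabla^\varphi_{e_i}\nabla^\varphi_{e_i}-\nabla^\varphi_{\nabla^M_{e_i}e_i})$ on sections of $\varphi^{-1}TN$, where $\nabla^\varphi$ is the induced connection. With $\tau=\tau(\varphi)$ and summation over $i$ understood, for $s\geq1$, $$\tau_{2s}(\varphi)=\overline\Delta^{2s-1}\tau-\varepsilon_iR^N(\overline\Delta^{2s-2}\tau,d\varphi(e_i))d\varphi(e_i)-\sum_{\ell=1}^{s-1}\{\varepsilon_iR^N(\nabla^\varphi_{e_i}\overline\Delta^{s+\ell-2}\tau,\overline\Delta^{s-\ell-1}\tau)d\varphi(e_i)-\varepsilon_iR^N(\overline\Delta^{s+\ell-2}\tau,\nabla^\varphi_{e_i}\overline\Delta^{s-\ell-1}\tau)d\varphi(e_i)\},$$ $$\tau_{2s+1}(\varphi)=\overline\Delta^{2s}\tau-\varepsilon_iR^N(\overline\Delta^{2s-1}\tau,d\varphi(e_i))d\varphi(e_i)-\sum_{\ell=1}^{s-1}\{\varepsilon_iR^N(\nabla^\varphi_{e_i}\overline\Delta^{s+\ell-1}\tau,\overline\Delta^{s-\ell-1}\tau)d\varphi(e_i)-\varepsilon_iR^N(\overline\Delta^{s+\ell-1}\tau,\nabla^\varphi_{e_i}\overline\Delta^{s-\ell-1}\tau)d\varphi(e_i)\}-\varepsilon_iR^N(\nabla^\varphi_{e_i}\overline\Delta^{s-1}\tau,\overline\Delta^{s-1}\tau)d\varphi(e_i).$$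 $\varphi$ is $r$-harmonic if $\tau_r(\varphi)=0$ ($r\ge2$). A hypersurface is $r$-harmonic if its isometric immersion is, and proper $r$-harmonic if in addition it is not minimal. *)

(* Defs.v *)
(* MathComp-Analysis; the real numbers are an arbitrary R : realType. *)
From HB Require Import structures.
From mathcomp Require Import all_boot all_order all_algebra.
From mathcomp Require Import all_classical all_reals all_analysis.

Set Implicit Arguments.
Unset Strict Implicit.
Unset Printing Implicit Defensive.

Import Order.TTheory GRing.Theory Num.Theory.
Import numFieldNormedType.Exports.

Local Open Scope classical_set_scope.
Local Open Scope ring_scope.

(* C^k and C^infinity maps on an open set. Functions are total, but only their
   values on the open set matter. *)
Fixpoint Ck_on {R : realType} {m n : nat} (k : nat) (U : set 'rV[R]_m)
    (f : 'rV[R]_m -> 'rV[R]_n) : Prop :=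
  match k with
  | 0%N => forall u, U u -> {for u, continuous f}
  | k'.+1 => (forall u, U u -> differentiable f u) /\
             (forall v, Ck_on k' U (fun u => 'D_v f u))
  end.

Definition smooth_on {R : realType} {m n : nat} (U : set 'rV[R]_m)
    (f : 'rV[R]_m -> 'rV[R]_n) : Prop :=
  forall k, Ck_on k U f.

(* Local pseudo-Riemannian geometry. A metric on (an open part of) R^n is
   given by its Gram matrix in the coordinate fields; tangent vectors are row
   vectors of components. *)

Definition coord_field {R : realType} {n : nat} (i : 'I_n) : 'rV[R]_n :=
  delta_mx 0 i.

Definition mdot {R : realType} {n : nat} (g : 'M[R]_n) (X Y : 'rV[R]_n) : R :=
  \sum_(i < n) \sum_(j < n) g i j * X 0 i * Y 0 j.

(* d_i h_jl at the point w *)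
Definition dmetric {R : realType} {n : nat} (h : 'rV[R]_n -> 'M[R]_n)
    (w : 'rV[R]_n) (i j l : 'I_n) : R :=
  ('D_(coord_field i) h w) j l.

(* christoffel h w k i j is Gamma^k_ij at w. *)
Definition christoffel {R : realType} {n : nat} (h : 'rV[R]_n -> 'M[R]_n)
    (w : 'rV[R]_n) (k i j : 'I_n) : R :=
  2^-1 * \sum_(l < n) (invmx (h w)) k l *
    (dmetric h w i j l + dmetric h w j i l - dmetric h w l i j).

(* d(phi)(X), a section of phi^{-1}TN, for a vector field X on the domain *)
Definition dmap {R : realType} {m n : nat} (phi : 'rV[R]_m -> 'rV[R]_n)
    (X : 'rV[R]_m -> 'rV[R]_m) (u : 'rV[R]_m) : 'rV[R]_n :=
  'D_(X u) phi u.

(* Covariant derivative of a section V of phi^{-1}TN along X for the connection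
   induced by the Levi-Civita connection of h. With phi := id this is the
   Levi-Civita connection itself. *)
Definition nabla {R : realType} {m n : nat} (h : 'rV[R]_n -> 'M[R]_n)
    (phi : 'rV[R]_m -> 'rV[R]_n) (X : 'rV[R]_m -> 'rV[R]_m)
    (V : 'rV[R]_m -> 'rV[R]_n) (u : 'rV[R]_m) : 'rV[R]_n :=
  'D_(X u) V u +
  \row_a \sum_(b < n) \sum_(d < n)
     christoffel h (phi u) a b d * dmap phi X u 0 b * V u 0 d.

(* R(X,Y)Z = nabla_X nabla_Y Z - nabla_Y nabla_X Z - nabla_[X,Y] Z, computed on
   the commuting coordinate fields and extended trilinearly. With this sign a
   space of constant curvature c has R(X,Y)Z = c(<Y,Z>X - <X,Z>Y). *)
Definition curvature {R : realType} {n : nat} (h : 'rV[R]_n -> 'M[R]_n)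
    (w X Y Z : 'rV[R]_n) : 'rV[R]_n :=
  let d (i : 'I_n) : 'rV[R]_n -> 'rV[R]_n := cst (coord_field i) in
  \sum_(a < n) \sum_(b < n) \sum_(k < n) (X 0 a * Y 0 b * Z 0 k) *:
    (nabla h id (d a) (nabla h id (d b) (d k)) w
     - nabla h id (d b) (nabla h id (d a) (d k)) w).

Definition orthonormal_frame {R : realType} {m : nat} (g : 'rV[R]_m -> 'M[R]_m)
    (U : set 'rV[R]_m) (e : 'I_m -> 'rV[R]_m -> 'rV[R]_m) (eps : 'I_m -> R) :
    Prop :=
  [/\ forall i, smooth_on U (e i),
      forall i, eps i = 1 \/ eps i = -1 &
      forall u, U u -> forall i j,
        mdot (g u) (e i u) (e j u) = if i == j then eps i else 0].

(* The r-tension field of phi : (U, g) -> (W, h), with respect to an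
   orthonormal frame e, eps of g. *)
Section RTension.
Context {R : realType} {m n : nat}.
Context (g : 'rV[R]_m -> 'M[R]_m) (h : 'rV[R]_n -> 'M[R]_n).
Context (phi : 'rV[R]_m -> 'rV[R]_n).
Context (e : 'I_m -> 'rV[R]_m -> 'rV[R]_m) (eps : 'I_m -> R).

Definition tension (u : 'rV[R]_m) : 'rV[R]_n :=
  \sum_(i < m) eps i *:
    (nabla h phi (e i) (dmap phi (e i)) u
     - dmap phi (nabla g id (e i) (e i)) u).

Definition rough_laplacian (V : 'rV[R]_m -> 'rV[R]_n) (u : 'rV[R]_m) :
    'rV[R]_n :=
  - \sum_(i < m) eps i *:
    (nabla h phi (e i) (nabla h phi (e i) V) u
     - nabla h phi (nabla g id (e i) (e i)) V u).

Definition lap_tension (k : nat) : 'rV[R]_m -> 'rV[R]_n :=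
  iter k rough_laplacian tension.

(* sum_i eps_i R^N(V_i, W_i) dphi(e_i) *)
Definition curv_trace (V W : 'I_m -> 'rV[R]_m -> 'rV[R]_n) (u : 'rV[R]_m) :
    'rV[R]_n :=
  \sum_(i < m) eps i *: curvature h (phi u) (V i u) (W i u) (dmap phi (e i) u).

Definition tension_even (s : nat) (u : 'rV[R]_m) : 'rV[R]_n :=
  lap_tension (2 * s - 1) u
  - curv_trace (fun=> lap_tension (2 * s - 2)) (fun i => dmap phi (e i)) u
  - \sum_(1 <= l < s)
      (curv_trace (fun i => nabla h phi (e i) (lap_tension (s + l - 2)))
                  (fun=> lap_tension (s - l - 1)) u
       - curv_trace (fun=> lap_tension (s + l - 2))
                    (fun i => nabla h phi (e i) (lap_tension (s - l - 1))) u).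

Definition tension_odd (s : nat) (u : 'rV[R]_m) : 'rV[R]_n :=
  lap_tension (2 * s) u
  - curv_trace (fun=> lap_tension (2 * s - 1)) (fun i => dmap phi (e i)) u
  - \sum_(1 <= l < s)
      (curv_trace (fun i => nabla h phi (e i) (lap_tension (s + l - 1)))
                  (fun=> lap_tension (s - l - 1)) u
       - curv_trace (fun=> lap_tension (s + l - 1))
                    (fun i => nabla h phi (e i) (lap_tension (s - l - 1))) u)
  - curv_trace (fun i => nabla h phi (e i) (lap_tension (s - 1)))
               (fun=> lap_tension (s - 1)) u.

(* Meaningful for r >= 2 only. *)
Definition r_tension (r : nat) : 'rV[R]_m -> 'rV[R]_n :=
  if odd r then tension_odd r./2 else tension_even r./2.

End RTension.

(* The scalar product of R^n_t. *)
Definition pdot {R : realType} {n : nat} (t : nat) (x y : 'rV[R]_n) : R :=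
  - (\sum_(i < n | (i < t)%N) x 0 i * y 0 i)
  + \sum_(i < n | (t <= i)%N) x 0 i * y 0 i.

(* S^n_t(c), a subset of R^{n+1}_t *)
Definition pseudosphere {R : realType} (n t : nat) (c : R) :
    set 'rV[R]_n.+1 :=
  [set x | pdot t x x = c^-1].
Arguments pseudosphere {R} n t c.

(* S^m_t(c) inside S^{m+1}_t, a subset of R^{m+2}_t *)
Definition small_pseudosphere {R : realType} (m t : nat) (c : R) :
    set 'rV[R]_m.+2 :=
  pseudosphere m.+1 t 1 `&` [set x | x 0 ord_max = Num.sqrt (1 - c^-1)].
Arguments small_pseudosphere {R} m t c.

(* Parametrizations psi : U -> S of (open pieces of) a d-dimensional
   submanifold S of R^n: since U is open in R^d with d = dim S, an injective
   immersion into S is a diffeomorphism onto an open subset of S. *)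
Definition local_param {R : realType} {d n : nat} (S : set 'rV[R]_n)
    (U : set 'rV[R]_d) (psi : 'rV[R]_d -> 'rV[R]_n) : Prop :=
  [/\ open U, smooth_on U psi, set_inj U psi, psi @` U `<=` S &
      forall u, U u -> row_free ('J psi u)].

(* The metric induced from R^n_t, in the coordinates given by psi. *)
Definition induced_metric {R : realType} {d n : nat} (t : nat)
    (psi : 'rV[R]_d -> 'rV[R]_n) (u : 'rV[R]_d) : 'M[R]_d :=
  \matrix_(i, j) pdot t ('D_(coord_field i) psi u) ('D_(coord_field j) psi u).

(* phi : U -> W is the expression of the inclusion M -> N in the
   parametrizations psi of M and theta of N. *)
Definition local_inclusion {R : realType} {m k n : nat} (M N : set 'rV[R]_n)
    (U : set 'rV[R]_m) (psi : 'rV[R]_m -> 'rV[R]_n)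
    (W : set 'rV[R]_k) (theta : 'rV[R]_k -> 'rV[R]_n)
    (phi : 'rV[R]_m -> 'rV[R]_k) : Prop :=
  [/\ local_param M U psi, local_param N W theta, smooth_on U phi,
      phi @` U `<=` W & forall u, U u -> theta (phi u) = psi u].

(* M (of dimension m) is an r-harmonic hypersurface of N, both being
   pseudo-Riemannian submanifolds of R^n_t. *)
Definition r_harmonic {R : realType} {n : nat} (m t r : nat)
    (M N : set 'rV[R]_n) : Prop :=
  forall (U : set 'rV[R]_m) (psi : 'rV[R]_m -> 'rV[R]_n)
         (W : set 'rV[R]_m.+1) (theta : 'rV[R]_m.+1 -> 'rV[R]_n)
         (phi : 'rV[R]_m -> 'rV[R]_m.+1),
  local_inclusion M N U psi W theta phi ->
  forall (e : 'I_m -> 'rV[R]_m -> 'rV[R]_m) (eps : 'I_m -> R),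
  orthonormal_frame (induced_metric t psi) U e eps ->
  forall u, U u ->
    r_tension (induced_metric t psi) (induced_metric t theta) phi e eps r u = 0.

Definition unit_normal {R : realType} {m : nat}
    (h : 'rV[R]_m.+1 -> 'M[R]_m.+1) (U : set 'rV[R]_m)
    (phi eta : 'rV[R]_m -> 'rV[R]_m.+1) (eps : R) : Prop :=
  [/\ smooth_on U eta, eps = 1 \/ eps = -1,
      forall u, U u -> mdot (h (phi u)) (eta u) (eta u) = eps &
      forall u, U u -> forall X, mdot (h (phi u)) (eta u) ('D_X phi u) = 0].

(* A u is the matrix, acting on row vectors X |-> X *m A u, of the shape
   operator A(X) = - nabla^N_X eta. *)
Definition shape_operator {R : realType} {m : nat}
    (h : 'rV[R]_m.+1 -> 'M[R]_m.+1) (U : set 'rV[R]_m)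
    (phi eta : 'rV[R]_m -> 'rV[R]_m.+1) (A : 'rV[R]_m -> 'M[R]_m) : Prop :=
  forall u, U u -> forall X : 'rV[R]_m,
    'D_(X *m A u) phi u = - nabla h phi (cst X) eta u.

Definition mean_curvature {R : realType} {m : nat} (eps : R)
    (A : 'rV[R]_m -> 'M[R]_m) (u : 'rV[R]_m) : R :=
  m%:R^-1 * eps * \tr (A u).

Definition minimal {R : realType} {n : nat} (m t : nat)
    (M N : set 'rV[R]_n) : Prop :=
  forall (U : set 'rV[R]_m) (psi : 'rV[R]_m -> 'rV[R]_n)
         (W : set 'rV[R]_m.+1) (theta : 'rV[R]_m.+1 -> 'rV[R]_n)
         (phi : 'rV[R]_m -> 'rV[R]_m.+1),
  local_inclusion M N U psi W theta phi ->
  forall (eta : 'rV[R]_m -> 'rV[R]_m.+1) (eps : R) (A : 'rV[R]_m -> 'M[R]_m),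
  unit_normal (induced_metric t theta) U phi eta eps ->
  shape_operator (induced_metric t theta) U phi eta A ->
  forall u, U u -> mean_curvature eps A u = 0.

Definition proper_r_harmonic {R : realType} {n : nat} (m t r : nat)
    (M N : set 'rV[R]_n) : Prop :=
  r_harmonic m t r M N /\ ~ minimal m t M N.

(* Main.v *)
(* The statement is read in the flat space R^{m+2}_t: a section V of phi^{-1}TN is
   replaced by d theta(V), and covariant differentiation becomes flat
   differentiation followed by projection. Let b be the height of M = S^m_t(c)
   and e the last basis vector. The field nu = e - b x is tangent to N, normal to
   M, satisfies <nu, nu> = 1/c and D_X nu = - b X. Hence M is totally umbilic,
   tau = mu nu with mu = m b c, and nu is an eigenvector of the rough Laplacian
   with eigenvalue lambda = m b^2 c = m (c - 1). As N has constant curvature 1,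
   every curvature term of tau_r is a multiple of nu, and altogether
     tau_r = mu lambda^(r-2) (lambda - m (r - 1)) nu
           = mu lambda^(r-2) m (c - r) nu.
   The mean curvature vanishes if and only if b = 0, that is, c = 1.
   Two existential points need an actual chart: M is not minimal for c > 1, and
   a nonzero coefficient gives a nonzero tau_r somewhere. Stereographic
   projection of N from a point of M supplies one: it maps M to an affine
   hyperplane and its metric is conformal to the flat one. *)

Require Import Defs.
From HB Require Import structures.
From mathcomp Require Import all_boot all_order all_algebra.
From mathcomp Require Import all_classical all_reals all_analysis.
From mathcomp Require Import ring lra zify.

Import Order.TTheory GRing.Theory Num.Theory.
Import numFieldNormedType.Exports.

Local Open Scope classical_set_scope.
Local Open Scope ring_scope.

Set Implicit Arguments.
Unset Strict Implicit.

(** Every field is a coordinate expression, a total function meaningful only on an open set, and the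
    Christoffel symbols hide an inverse matrix. Hence vector identities are checked in the flat
    space by pairing both sides with a spanning family, so that nondegeneracy does the work that
    positivity would do in the Riemannian case. For N the family consists of the tangent vectors and
    the position vector; for M the vector e is added, and its independence rests on the Gram
    determinant 1 - b^2 = 1/c of e and the position. Iterating the rough Laplacian asks for only one
    derivative of nu: each iterate is again a constant multiple of nu on the whole chart, and the
    covariant derivative of nu is a multiple of d phi. The factor r - 1 counts curvature terms, and
    they all carry the same power of lambda because b mu = lambda. The computation holds for every
    chart of any subset of the small pseudosphere. Only the explicit chart must respect the
    connected component of p: it is centred at p and has a star-shaped domain. *)

(* The limit defining 'D_v f x is sealed: otherwise unification unfolds it
   whenever two derivatives in different directions are compared. *)
HB.lock Definition pder {R : realType} {V W : normedModType R} (v : V)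
  (f : V -> W) (x : V) : W := 'D_v f x.

Lemma pderE {R : realType} {V W : normedModType R} (v : V) (f : V -> W) x :
  pder v f x = 'D_v f x.
Proof. by rewrite pder.unlock. Qed.

Lemma pder_diff {R : realType} {V W : normedModType R} (f : V -> W) x v :
  differentiable f x -> pder v f x = 'd f x v.
Proof. by rewrite pderE => /deriveE ->. Qed.

(** * Directional derivatives *)

Section Calculus.
Context {R : realType} {V : normedModType R}.
Implicit Types (x v : V).

Lemma near_open (U : set V) (P : V -> Prop) x :
  open U -> U x -> (forall y, U y -> P y) -> \forall y \near x, P y.
Proof. by move=> oU Ux UP; apply: filterS UP _; exact: open_nbhs_nbhs. Qed.

Lemma pder_eq_on (U : set V) (W : normedModType R) (f g : V -> W) x v :
  open U -> U x -> (forall y, U y -> f y = g y) -> pder v f x = pder v g x.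
Proof. by move=> oU Ux fg; rewrite !pderE; apply: near_eq_derive; exact: near_open oU Ux fg. Qed.

(** The difference [g - f] vanishes near [x], so its differential there is zero. Closed formulas for
    the geometric fields hold only on an open set; this carries differentiability across them. *)
Lemma differentiable_eq_on (U : set V) (W : normedModType R) (f g : V -> W) x :
  open U -> U x -> (forall y, U y -> f y = g y) ->
  differentiable f x -> differentiable g x.
Proof.
move=> oU Ux fg df; rewrite -(subrKC f g) -/(f + (g - f)).
apply: differentiableD; first exact: df.
have nU : \forall y \near x, U y by exact: open_nbhs_nbhs.
set k := g - f.
have k0 y : U y -> k y = 0 by move=> /fg fgy; rewrite /k !fctE fgy subrr.
have ek : k \o shift x = cst (k x) + \0 +o_ 0 id.
  apply/eqaddoP => _/posnumP[e]; near=> h.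
  rewrite /= !fctE /= (k0 _ Ux) (k0 (h + x)) ?addr0 ?subr0 ?normr0 ?mulr_ge0//.
  by near: h; move: nU; rewrite (near_shift 0) /= subr0.
have dk : 'd k x = \0 :> (V -> W) by apply: diff_unique => //; exact: cst_continuous.
by apply/diff_locallyP; rewrite dk; split => //; exact: cst_continuous.
Unshelve. all: by end_near. Qed.

Lemma differentiable_sumf (W : normedModType R) (I : finType) (f : I -> V -> W) x :
  (forall i, differentiable (f i) x) ->
  differentiable (fun y => \sum_i f i y) x.
Proof.
move=> df; rewrite (_ : (fun _ => _) = \sum_i f i).
  elim/big_ind : _ => [|g h dg dh|i _]; last exact: df.
    exact: differentiable_cst.
  exact: differentiableD.
by apply/funext => y; rewrite fct_sumE.
Qed.

Lemma pder_sumf (W : normedModType R) n (f : 'I_n -> V -> W) x v :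
  (forall i, differentiable (f i) x) ->
  pder v (fun y => \sum_(i < n) f i y) x = \sum_(i < n) pder v (f i) x.
Proof.
move=> df; rewrite (_ : (fun _ => _) = \sum_(i < n) f i).
  rewrite pderE derive_sum => [|i]; last exact: diff_derivable.
  by apply: eq_bigr => i _; rewrite pderE.
by apply/funext => y; rewrite fct_sumE.
Qed.

Lemma pder_comp (W Z : normedModType R) (f : V -> W) (g : W -> Z) x v :
  differentiable f x -> differentiable g (f x) ->
  pder v (fun y => g (f y)) x = pder (pder v f x) g (f x).
Proof.
move=> df dg; rewrite -/(g \o f) (pder_diff _ (differentiable_comp df dg)).
by rewrite (pder_diff _ df) (pder_diff _ dg) diff_comp.
Qed.

Lemma pderDr (W : normedModType R) (f : V -> W) x u v :
  differentiable f x -> pder (u + v) f x = pder u f x + pder v f x.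
Proof. by move=> df; rewrite !(pder_diff _ df) linearD. Qed.

Lemma pderZr (W : normedModType R) (f : V -> W) x (a : R) v :
  differentiable f x -> pder (a *: v) f x = a *: pder v f x.
Proof. by move=> df; rewrite !(pder_diff _ df) linearZ. Qed.

Lemma pder_sumr (W : normedModType R) (f : V -> W) x n (v : 'I_n -> V) :
  differentiable f x ->
  pder (\sum_(i < n) v i) f x = \sum_(i < n) pder (v i) f x.
Proof.
move=> df; rewrite (pder_diff _ df) linear_sum.
by apply: eq_bigr => i _; rewrite (pder_diff _ df).
Qed.

Lemma pderMf (f g : V -> R) x v : differentiable f x -> differentiable g x ->
  pder v (fun y => f y * g y) x = f x * pder v g x + g x * pder v f x.
Proof. by move=> df dg; rewrite !pderE; apply: deriveM; exact: diff_derivable. Qed.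

Lemma pderDf (W : normedModType R) (f g : V -> W) x v :
  differentiable f x -> differentiable g x ->
  pder v (fun y => f y + g y) x = pder v f x + pder v g x.
Proof. by move=> df dg; rewrite !pderE; apply: deriveD; exact: diff_derivable. Qed.

Lemma pderZf (W : normedModType R) (a : R) (f : V -> W) x v :
  differentiable f x -> pder v (fun y => a *: f y) x = a *: pder v f x.
Proof. by move=> df; rewrite !pderE; apply: deriveZ; exact: diff_derivable. Qed.

Lemma differentiable_mxE m n (F : V -> 'M[R]_(m, n)) x i j :
  differentiable F x -> differentiable (fun y => F y i j) x.
Proof.
move=> dF; apply: (@differentiable_comp _ _ _ _ F (fun N : 'M[R]_(m, n) => N i j)) => //.
exact: differentiable_coord.
Qed.

Lemma differentiable_mxP m n (F : V -> 'M[R]_(m, n)) x :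
  (forall i j, differentiable (fun y => F y i j) x) -> differentiable F x.
Proof.
move=> dF.
rewrite (_ : F = fun y => \sum_(i < m) \sum_(j < n) F y i j *: delta_mx i j).
  apply: differentiable_sumf => i; apply: differentiable_sumf => j.
  exact: differentiableZl.
by apply/funext => y; exact: matrix_sum_delta.
Qed.

Lemma pder_mxE m n (F : V -> 'M[R]_(m, n)) x v i j :
  differentiable F x -> (pder v F x) i j = pder v (fun y => F y i j) x.
Proof.
by move=> dF; rewrite !pderE derive_mx ?mxE//; exact: diff_derivable.
Qed.

Lemma differentiable_scale m n (k : V -> R) (F : V -> 'M[R]_(m, n)) x :
  differentiable k x -> differentiable F x ->
  differentiable (fun y => k y *: F y) x.
Proof.
move=> dk dF; apply: differentiable_mxP => i j.
rewrite (_ : (fun _ => _) = (k * (fun y => F y i j))).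
  by apply: differentiableM => //; exact: differentiable_mxE.
by apply/funext => y; rewrite mxE.
Qed.

Lemma pder_scale m n (k : V -> R) (F : V -> 'M[R]_(m, n)) x v :
  differentiable k x -> differentiable F x ->
  pder v (fun y => k y *: F y) x = pder v k x *: F x + k x *: pder v F x.
Proof.
move=> dk dF; apply/matrixP => i j.
rewrite pder_mxE; last exact: differentiable_scale.
rewrite !mxE (pder_mxE _ _ _ dF).
rewrite (_ : (fun _ => _) = fun y => k y * F y i j); last first.
  by apply/funext => y; rewrite mxE.
rewrite pderMf; [ring | exact: dk | exact: differentiable_mxE].
Qed.

Lemma differentiable_prod n (f : 'I_n -> V -> R) x :
  (forall i, differentiable (f i) x) ->
  differentiable (fun y => \prod_(i < n) f i y) x.
Proof.
elim: n f => [|n IHn] f df.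
  rewrite (_ : (fun _ => _) = cst 1) //.
  by apply/funext => y; rewrite big_ord0.
rewrite (_ : (fun _ => _) = (f ord0 * (fun y => \prod_(i < n) f (lift ord0 i) y))).
  by apply: differentiableM => //; exact: IHn.
by apply/funext => y; rewrite big_ord_recl.
Qed.

Lemma differentiable_det n (F : V -> 'M[R]_n) x :
  differentiable F x -> differentiable (fun y => \det (F y)) x.
Proof.
move=> dF; rewrite /determinant.
apply: differentiable_sumf => s; apply: differentiableZ.
by apply: differentiable_prod => j; exact: differentiable_mxE.
Qed.

Lemma differentiable_mulmx m n p (F : V -> 'M[R]_(m, n)) (H : V -> 'M[R]_(n, p)) x :
  differentiable F x -> differentiable H x ->
  differentiable (fun y => F y *m H y) x.
Proof.
move=> dF dH; apply: differentiable_mxP => i j.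
rewrite (_ : (fun _ => _) = fun y => \sum_k F y i k * H y k j).
  apply: differentiable_sumf => k.
  by apply: differentiableM; exact: differentiable_mxE.
by apply/funext => y; rewrite mxE.
Qed.

Lemma differentiable_adjugate n (F : V -> 'M[R]_n) x :
  differentiable F x -> differentiable (fun y => \adj (F y)) x.
Proof.
move=> dF; apply: differentiable_mxP => i j.
rewrite (_ : (fun _ => _) =
  fun y => (-1) ^+ (j + i) * \det (row' j (col' i (F y)))).
  apply: differentiableZ; apply: differentiable_det.
  apply: differentiable_mxP => k l.
  rewrite (_ : (fun _ => _) = fun y => F y (lift j k) (lift i l)).
    exact: differentiable_mxE.
  by apply/funext => y; rewrite !mxE.
by apply/funext => y; rewrite mxE.
Qed.

(** Cramer's formula gives the inverse through determinants, but only where the matrix is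
    invertible; hence the open set [U]. *)
Lemma differentiable_invmx n (U : set V) (H : V -> 'M[R]_n) x :
  open U -> U x -> (forall y, U y -> H y \in unitmx) ->
  differentiable H x -> differentiable (fun y => invmx (H y)) x.
Proof.
move=> oU Ux uH dH.
apply: (@differentiable_eq_on U _ (fun y => (\det (H y))^-1 *: \adj (H y)) _ x oU Ux).
  by move=> y /uH uHy; rewrite /invmx uHy.
apply: differentiable_scale; last exact: differentiable_adjugate.
apply: differentiableV; first exact: differentiable_det.
by have := uH _ Ux; rewrite unitmxE unitfE.
Qed.

(** Gives regularity of a field known only through a linear system, such as a covariant derivative
    determined by its scalar products. *)
Lemma differentiable_solve n (U : set V) (H : V -> 'M[R]_n) (w z : V -> 'rV[R]_n) x :
  open U -> U x -> (forall y, U y -> H y \in unitmx) ->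
  (forall y, U y -> w y *m H y = z y) ->
  differentiable H x -> differentiable z x -> differentiable w x.
Proof.
move=> oU Ux uH wH dH dz.
apply: (@differentiable_eq_on U _ (fun y => z y *m invmx (H y)) _ x oU Ux).
  by move=> y Uy; rewrite -(wH _ Uy) mulmxK// uH.
apply: differentiable_mulmx => //.
exact: (differentiable_invmx oU Ux uH dH).
Qed.

End Calculus.
(** * Symmetry of second derivatives *)

Section SymmetryOfSecondDerivatives.
Context {R : realType} {V : normedModType R}.
Implicit Types (f : V -> R) (x v w : V).

Lemma is_derive_line f y v (s : R) : derivable f (s *: v + y) v ->
  is_derive s 1 (fun r : R => f (r *: v + y)) ('D_v f (s *: v + y)).
Proof.
move=> df.
have E : (fun h : R => h^-1 *: (f ((h *: 1 + s) *: v + y) - f (s *: v + y)))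
  = (fun h : R => h^-1 *: (f (h *: v + (s *: v + y)) - f (s *: v + y))).
  by apply/funext => h; rewrite scalerDl addrA [h *: 1]mulr1.
by apply: DeriveDef; [rewrite /derivable E | rewrite /derive E].
Qed.

(** The mean value theorem is applied first to the increment of [f] over [h *: w], as a function of
    the parameter along [v], and then to ['D_v f] along [w]. *)
Lemma double_difference f x v w (h : R) : 0 < h ->
  (forall s t : R, 0 <= s <= h -> 0 <= t <= h ->
     derivable f (s *: v + (t *: w + x)) v /\
     derivable (fun z => 'D_v f z) (s *: v + (t *: w + x)) w) ->
  exists s t : R, [/\ 0 <= s <= h, 0 <= t <= h &
    f (h *: v + (h *: w + x)) - f (h *: v + x) - (f (h *: w + x) - f x)
    = h ^+ 2 * 'D_w (fun z => 'D_v f z) (s *: v + (t *: w + x))].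
Proof.
move=> h0 df.
have hh : 0 <= h <= h by rewrite lexx ltW.
have h00 : (0 : R) <= 0 <= h by rewrite lexx ltW.
pose F (s : R) := f (s *: v + (h *: w + x)) - f (s *: v + x).
have dF s : 0 <= s <= h -> is_derive s 1 F
    ('D_v f (s *: v + (h *: w + x)) - 'D_v f (s *: v + x)).
  move=> sh; apply: is_deriveB.
    by apply: is_derive_line; have [] := df _ _ sh hh.
  by apply: is_derive_line; have [] := df _ _ sh h00; rewrite scale0r add0r.
have [s sh Es] : exists2 s, s \in `]0, h[%R & F h - F 0 =
    ('D_v f (s *: v + (h *: w + x)) - 'D_v f (s *: v + x)) * (h - 0).
  apply: (MVT h0 (f := F)) => [s|].
    by rewrite in_itv /= => /andP[/ltW s0 /ltW sh]; apply: dF; rewrite s0.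
  apply: derivable_within_continuous => s; rewrite in_itv /= => sh.
  by have [] := dF _ sh.
have {}sh : 0 <= s <= h by move: sh; rewrite in_itv /= => /andP[/ltW -> /ltW].
pose G (t : R) := 'D_v f (t *: w + (s *: v + x)).
have dG t : 0 <= t <= h -> is_derive t 1 G
    ('D_w (fun z => 'D_v f z) (t *: w + (s *: v + x))).
  move=> th; apply: (@is_derive_line (fun z => 'D_v f z)).
  by have [_] := df _ _ sh th; rewrite addrCA.
have [t th Et] : exists2 t, t \in `]0, h[%R & G h - G 0 =
    'D_w (fun z => 'D_v f z) (t *: w + (s *: v + x)) * (h - 0).
  apply: (MVT h0 (f := G)) => [t|].
    by rewrite in_itv /= => /andP[/ltW t0 /ltW th]; apply: dG; rewrite t0.
  apply: derivable_within_continuous => t; rewrite in_itv /= => th.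
  by have [] := dG _ th.
have {}th : 0 <= t <= h by move: th; rewrite in_itv /= => /andP[/ltW -> /ltW].
exists s, t; split => //; rewrite [s *: v + _]addrCA.
move: Es; rewrite {1 2}/F !scale0r !add0r => ->.
move: Et; rewrite {1 2}/G scale0r add0r [h *: w + _]addrCA => ->.
by rewrite subr0 expr2 -mulrA mulrC.
Qed.

(** The limit argument in isolation: [A] and [B] take a common value, at possibly different points,
    on arbitrarily small parallelograms at [x]. *)
Lemma eq_of_near_values (U : set V) (A B : V -> R) x v w : open U -> U x ->
  {for x, continuous A} -> {for x, continuous B} ->
  (forall h : R, 0 < h ->
     (forall s t : R, 0 <= s <= h -> 0 <= t <= h -> U (s *: v + (t *: w + x))) ->
     exists s t s' t' : R, [/\ 0 <= s <= h, 0 <= t <= h, 0 <= s' <= h, 0 <= t' <= h &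
       A (s *: v + (t *: w + x)) = B (s' *: v + (t' *: w + x))]) ->
  A x = B x.
Proof.
move=> oU Ux cA cB AB.
apply/eqP; rewrite -subr_eq0 -normr_le0; apply/ler_addgt0Pr => e e0; rewrite add0r.
have nU : \forall z \near x, U z by exact: open_nbhs_nbhs.
have e20 : 0 < e / 2 by rewrite divr_gt0.
have /nbhs_ballP[d /= d0 dP] : \forall z \near x,
    [/\ U z, `|A x - A z| < e / 2 & `|B x - B z| < e / 2].
  move/cvgrPdist_lt : cA => /(_ _ e20) nA; move/cvgrPdist_lt : cB => /(_ _ e20) nB.
  by move: nU nA nB; apply: filterS3.
(* The parallelogram must stay in the ball of radius [d]; the summand 1 keeps the denominator
   positive when [v] and [w] both vanish. *)
pose h := d / (2 * (`|v| + `|w| + 1)).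
have K0 : 0 < 2 * (`|v| + `|w| + 1).
  by rewrite mulr_gt0// ltr_wpDl// addr_ge0.
have h0 : 0 < h by rewrite divr_gt0.
have hd : h * (`|v| + `|w|) < d.
  rewrite /h mulrAC ltr_pdivrMr// ltr_pM2l//.
  by have := normr_ge0 v; have := normr_ge0 w; lra.
have inball (s t : R) : 0 <= s <= h -> 0 <= t <= h ->
    [/\ U (s *: v + (t *: w + x)), `|A x - A (s *: v + (t *: w + x))| < e / 2 &
        `|B x - B (s *: v + (t *: w + x))| < e / 2].
  move=> /andP[s0 sh] /andP[t0 th]; apply: dP.
  rewrite -ball_normE /ball_ /= addrA opprD addrCA subrr addr0 normrN.
  apply: le_lt_trans hd; rewrite mulrDr; apply: le_trans (ler_normD _ _) _.
  by rewrite !normrZ (ger0_norm s0) (ger0_norm t0) lerD// ler_wpM2r.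
have [|s [t [s' [t' [sh th sh' th' {}AB]]]]] := AB h h0.
  by move=> s t sh th; have [] := inball _ _ sh th.
have [_ a1 _] := inball _ _ sh th; have [_ _ b1] := inball _ _ sh' th'.
rewrite -(subrKA (A (s *: v + (t *: w + x)))) {2}AB.
rewrite (le_trans (ler_normD _ _))// (splitr e) lerD// ltW//.
by rewrite distrC.
Qed.

(** The second difference of [f] over a parallelogram is symmetric in [v] and [w], and it equals
    [h ^+ 2] times either mixed derivative at some point of the parallelogram. *)
Lemma derive_symm (U : set V) f x v w : open U -> U x ->
  (forall z, U z -> derivable f z v /\ derivable f z w) ->
  (forall z, U z -> derivable (fun y => 'D_v f y) z w /\
                    derivable (fun y => 'D_w f y) z v) ->
  {for x, continuous (fun z => 'D_w (fun y => 'D_v f y) z)} ->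
  {for x, continuous (fun z => 'D_v (fun y => 'D_w f y) z)} ->
  'D_w (fun y => 'D_v f y) x = 'D_v (fun y => 'D_w f y) x.
Proof.
move=> oU Ux d1 d2 cA cB; apply: (eq_of_near_values oU Ux cA cB) => h h0 hU.
have [|s [t [sh th Eh]]] := @double_difference f x v w h h0.
  move=> s t sh th; have Uz := hU _ _ sh th.
  by split; [exact: (proj1 (d1 _ Uz)) | exact: (proj1 (d2 _ Uz))].
have [|s' [t' [sh' th' Eh']]] := @double_difference f x w v h h0.
  move=> s' t' sh' th'; have Uz := hU _ _ th' sh'; rewrite addrCA.
  by split; [exact: (proj2 (d1 _ Uz)) | exact: (proj2 (d2 _ Uz))].
exists s, t, t', s'; split; [exact: sh|exact: th|exact: th'|exact: sh'|].
apply: (@mulfI _ (h ^+ 2)); first by rewrite expf_neq0// gt_eqF.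
apply: etrans (esym Eh) _; rewrite [t' *: v + _]addrCA; apply: etrans Eh'.
rewrite [h *: w + (h *: v + x)]addrCA.
by rewrite !opprB [LHS]addrACA [RHS]addrACA; congr (_ + _); exact: addrC.
Qed.

End SymmetryOfSecondDerivatives.

(** * Smooth maps between coordinate spaces *)

Section Smooth.
Context {R : realType} {m n : nat}.
Implicit Types (U : set 'rV[R]_m) (f : 'rV[R]_m -> 'rV[R]_n).

Lemma smooth_differentiable U f u : smooth_on U f -> U u -> differentiable f u.
Proof. by move=> sf Uu; exact: (sf 1%N).1. Qed.

Lemma smooth_pder U f v : smooth_on U f -> smooth_on U (pder v f).
Proof.
move=> sf k; rewrite (_ : pder v f = fun u => 'D_v f u); first exact: (sf k.+1).2.
by apply/funext => u; rewrite pderE.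
Qed.

Lemma smooth_continuous U f u : smooth_on U f -> U u -> {for u, continuous f}.
Proof. by move=> sf Uu; exact: (sf 0%N). Qed.

Lemma pder_pder_mxE U f u v w j : open U -> U u -> smooth_on U f ->
  (pder w (pder v f) u) 0 j = pder w (pder v (fun z => f z 0 j)) u.
Proof.
move=> oU Uu sf; rewrite pder_mxE; last first.
  exact: (smooth_differentiable (smooth_pder v sf) Uu).
apply: (pder_eq_on _ oU Uu) => y Uy.
by rewrite pder_mxE//; exact: (smooth_differentiable sf Uy).
Qed.

Lemma smooth_pder_symm U f u v w : open U -> U u -> smooth_on U f ->
  pder w (pder v f) u = pder v (pder w f) u.
Proof.
move=> oU Uu sf; apply/rowP => j.
rewrite (pder_pder_mxE v w j oU Uu sf) (pder_pder_mxE w v j oU Uu sf).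
have d1 z : U z -> differentiable (fun y => f y 0 j) z.
  by move=> Uz; exact: (differentiable_mxE 0 j (smooth_differentiable sf Uz)).
have d2 z v' : U z -> differentiable (pder v' (fun y => f y 0 j)) z.
  move=> Uz; apply: (@differentiable_eq_on _ _ U _ (fun y => pder v' f y 0 j) _ z oU Uz).
    by move=> y Uy; rewrite pder_mxE//; exact: (smooth_differentiable sf Uy).
  exact: (differentiable_mxE 0 j (smooth_differentiable (smooth_pder v' sf) Uz)).
have c2 v' w' : {for u, continuous (pder w' (pder v' (fun y => f y 0 j)))}.
  have dd := smooth_differentiable (smooth_pder w' (smooth_pder v' sf)) Uu.
  apply: differentiable_continuous.
  apply: (@differentiable_eq_on _ _ U _ _ _ u oU Uu) (differentiable_mxE 0 j dd).
  by move=> y Uy; rewrite (pder_pder_mxE _ _ j oU Uy sf).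
have pderD v' (g : 'rV[R]_m -> R) : pder v' g = fun y => 'D_v' g y.
  by apply/funext => y; rewrite pderE.
rewrite !pderD; apply: (derive_symm oU Uu) => [z Uz|z Uz||].
- by split; apply: diff_derivable; exact: d1.
- by split; apply: diff_derivable; rewrite -pderD; exact: d2.
- by rewrite -!pderD; exact: c2.
- by rewrite -!pderD; exact: c2.
Qed.

Lemma pder_coord f u v : differentiable f u ->
  pder v f u = \sum_(d < m) v 0 d *: pder (coord_field d) f u.
Proof.
move=> df; rewrite {1}(row_sum_delta v) (pder_sumr _ df).
by apply: eq_bigr => d _; rewrite (pderZr _ _ df).
Qed.

Lemma pder_jacobian f u v : differentiable f u -> pder v f u = v *m 'J f u.
Proof. by move=> df; rewrite pderE deriveEjacobian. Qed.

End Smooth.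

(** * The pseudo-Euclidean scalar product *)

Section PseudoScalarProduct.
Context {R : realType} {n : nat} (t : nat).
Implicit Types (x y z : 'rV[R]_n).

Definition psign (i : nat) : R := if (i < t)%N then -1 else 1.

Lemma pdotE x y : pdot t x y = \sum_(i < n) psign i * (x 0 i * y 0 i).
Proof.
rewrite /pdot [RHS](bigID (fun i : 'I_n => (i < t)%N)) /=; congr (_ + _).
  by rewrite -sumrN; apply: eq_bigr => i it; rewrite /psign it mulN1r.
apply: eq_big => [i|i it]; first by rewrite -leqNgt.
by rewrite /psign ltnNge it mul1r.
Qed.

Lemma pdotC x y : pdot t x y = pdot t y x.
Proof. by rewrite !pdotE; apply: eq_bigr => i _; rewrite [x 0 i * _]mulrC. Qed.

Lemma pdotDl x y z : pdot t (x + y) z = pdot t x z + pdot t y z.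
Proof.
rewrite !pdotE -big_split; apply: eq_bigr => i _ /=.
by rewrite mxE mulrDl mulrDr.
Qed.

Lemma pdotZl a x z : pdot t (a *: x) z = a * pdot t x z.
Proof.
rewrite !pdotE mulr_sumr; apply: eq_bigr => i _.
by rewrite mxE -mulrA [RHS]mulrCA.
Qed.

Lemma pdot0l z : pdot t 0 z = 0.
Proof. by rewrite -(scale0r 0) pdotZl mul0r. Qed.

Lemma pdotNl x z : pdot t (- x) z = - pdot t x z.
Proof. by rewrite -scaleN1r pdotZl mulN1r. Qed.

Lemma pdotBl x y z : pdot t (x - y) z = pdot t x z - pdot t y z.
Proof. by rewrite pdotDl pdotNl. Qed.

Lemma pdotDr x y z : pdot t z (x + y) = pdot t z x + pdot t z y.
Proof. by rewrite pdotC pdotDl !(pdotC z). Qed.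

Lemma pdotZr a x z : pdot t z (a *: x) = a * pdot t z x.
Proof. by rewrite pdotC pdotZl (pdotC z). Qed.

Lemma pdot0r z : pdot t z 0 = 0.
Proof. by rewrite pdotC pdot0l. Qed.

Lemma pdotNr x z : pdot t z (- x) = - pdot t z x.
Proof. by rewrite pdotC pdotNl pdotC. Qed.

Lemma pdotBr x y z : pdot t z (x - y) = pdot t z x - pdot t z y.
Proof. by rewrite pdotDr pdotNr. Qed.

Lemma pdot_suml (I : finType) (F : I -> 'rV[R]_n) z :
  pdot t (\sum_i F i) z = \sum_i pdot t (F i) z.
Proof. by elim/big_ind2 : _ => [|x a y b <- <-|//]; rewrite ?pdot0l ?pdotDl. Qed.

Lemma pdot_sumr (I : finType) (F : I -> 'rV[R]_n) z :
  pdot t z (\sum_i F i) = \sum_i pdot t z (F i).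
Proof. by rewrite pdotC pdot_suml; apply: eq_bigr => i _; rewrite pdotC. Qed.

Lemma pdot_deltal (i : 'I_n) x : pdot t (delta_mx 0 i) x = psign i * x 0 i.
Proof.
rewrite pdotE (bigD1 i)//= mxE !eqxx mul1r big1 ?addr0// => j ji.
by rewrite mxE (negbTE ji) andbF mul0r mulr0.
Qed.

Lemma psign_neq0 i : psign i != 0.
Proof. by rewrite /psign; case: ifP => _; rewrite ?oppr_eq0 oner_eq0. Qed.

Lemma pdot_eq0 x : (forall y, pdot t x y = 0) -> x = 0.
Proof.
move=> x0; apply/rowP => i; have := x0 (delta_mx 0 i).
rewrite pdotC pdot_deltal mxE => /eqP; rewrite mulf_eq0 (negbTE (psign_neq0 i)).
by move/eqP.
Qed.

(** Nondegeneracy in the form used throughout: it reduces vector identities of the flat space to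
    scalar ones. *)
Lemma pdot_row_full k (B : 'M[R]_(k, n)) x : row_full B ->
  (forall i, pdot t x (row i B) = 0) -> x = 0.
Proof.
move=> /row_fullP[C CB] xB; apply: pdot_eq0 => y.
rewrite -[y]mulmx1 -CB mulmxA mulmx_sum_row pdot_sumr big1// => i _.
by rewrite pdotZr xB mulr0.
Qed.

Context {V : normedModType R}.
Implicit Types (F G : V -> 'rV[R]_n) (u v : V).

Lemma differentiable_pdot F G u : differentiable F u -> differentiable G u ->
  differentiable (fun p => pdot t (F p) (G p)) u.
Proof.
move=> dF dG; under eq_fun do rewrite pdotE.
apply: differentiable_sumf => i; apply: differentiableZ.
by apply: differentiableM; exact: differentiable_mxE.
Qed.

Lemma pder_pdot F G u v : differentiable F u -> differentiable G u ->
  pder v (fun p => pdot t (F p) (G p)) u =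
  pdot t (pder v F u) (G u) + pdot t (F u) (pder v G u).
Proof.
move=> dF dG; under eq_fun do rewrite pdotE.
have dFG i : differentiable (fun p => F p 0 i * G p 0 i) u.
  by apply: differentiableM; exact: differentiable_mxE.
rewrite pder_sumf => [|i]; last exact: differentiableZ.
rewrite !pdotE -big_split; apply: eq_bigr => i _ /=.
rewrite pderZf// pderMf; [|exact: differentiable_mxE..].
rewrite (pder_mxE _ _ _ dF) (pder_mxE _ _ _ dG).
by rewrite [RHS]addrC -mulrDr [G u 0 i * _]mulrC.
Qed.

End PseudoScalarProduct.
(** * The Levi-Civita connection of an induced metric *)

Section InducedMetric.
Context {R : realType} {d n : nat} (t : nat).
Context (W : set 'rV[R]_d) (theta : 'rV[R]_d -> 'rV[R]_n).
Context (oW : open W) (sT : smooth_on W theta).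

Local Notation h := (induced_metric t theta).
Local Notation D1 i := (pder (coord_field i) theta).
Local Notation D2 i j := (pder (coord_field i) (pder (coord_field j) theta)).

Let dT w : W w -> differentiable theta w.
Proof. exact: smooth_differentiable. Qed.

Let dT1 v w : W w -> differentiable (pder v theta) w.
Proof. exact/smooth_differentiable/smooth_pder. Qed.

Lemma induced_metricE w i j : h w i j = pdot t (D1 i w) (D1 j w).
Proof. by rewrite mxE !pderE. Qed.

Lemma induced_metric_sym w i j : h w i j = h w j i.
Proof. by rewrite !induced_metricE pdotC. Qed.

Lemma mdot_induced w X Y : W w ->
  mdot (h w) X Y = pdot t (pder X theta w) (pder Y theta w).
Proof.
move=> Ww; rewrite (pder_coord X (dT Ww)) (pder_coord Y (dT Ww)) pdot_suml.
apply: eq_bigr => i _; rewrite pdot_sumr; apply: eq_bigr => j _.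
by rewrite pdotZl pdotZr induced_metricE; ring.
Qed.

Lemma differentiable_induced_metric w : W w -> differentiable h w.
Proof.
move=> Ww; apply: differentiable_mxP => i j.
rewrite (_ : (fun _ => _) = fun y => pdot t (D1 i y) (D1 j y)).
  by apply: differentiable_pdot; exact: dT1.
by apply/funext => y; rewrite induced_metricE.
Qed.

Lemma dmetricE w i j l : W w ->
  dmetric h w i j l = pdot t (D2 i j w) (D1 l w) + pdot t (D1 j w) (D2 i l w).
Proof.
move=> Ww; rewrite /dmetric -pderE pder_mxE; last exact: differentiable_induced_metric.
rewrite (_ : (fun _ => _) = fun y => pdot t (D1 j y) (D1 l y)).
  by rewrite pder_pdot//; exact: dT1.
by apply/funext => y; rewrite induced_metricE.
Qed.

(** Koszul's formula: of the six terms with second derivatives of [theta], four cancel by symmetry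
    and the other two coincide, which absorbs the factor 1/2. *)
Lemma christoffel_lower w b e l : W w -> h w \in unitmx ->
  \sum_a christoffel h w a b e * h w a l = pdot t (D2 b e w) (D1 l w).
Proof.
move=> Ww uh; rewrite /christoffel.
pose c k := pdot t (D2 b e w) (D1 k w).
have cE k : dmetric h w b e k + dmetric h w e b k - dmetric h w k b e = 2 * c k.
  rewrite !(dmetricE _ _ _ Ww) (smooth_pder_symm (coord_field b) (coord_field e) oW Ww sT).
  rewrite (smooth_pder_symm (coord_field k) (coord_field b) oW Ww sT).
  rewrite (smooth_pder_symm (coord_field k) (coord_field e) oW Ww sT).
  rewrite /c (pdotC t (D1 e w)) (pdotC t (D1 b w)); ring.
(* By symmetry of the metric, the sum over [a] is now an entry of [h w *m invmx (h w)]. *)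
transitivity (\sum_a \sum_k c k * (h w l a * invmx (h w) a k)).
  apply: eq_bigr => a _; rewrite mulr_sumr mulr_suml; apply: eq_bigr => k _.
  by rewrite cE (induced_metric_sym w l a); field.
rewrite exchange_big /= (bigD1 l)//= [X in _ + X]big1 ?addr0 => [|k kl].
  rewrite -mulr_sumr (_ : \sum_i _ = (h w *m invmx (h w)) l l).
    by rewrite mulmxV// mxE eqxx mulr1.
  by rewrite mxE.
rewrite -mulr_sumr (_ : \sum_i _ = (h w *m invmx (h w)) l k).
  by rewrite mulmxV// mxE eq_sym (negbTE kl) mulr0.
by rewrite mxE.
Qed.

Lemma mul_induced_metric w (Z : 'rV[R]_d) l : W w ->
  (Z *m h w) 0 l = pdot t (pder Z theta w) (D1 l w).
Proof.
move=> Ww; rewrite (pder_coord Z (dT Ww)) pdot_suml mxE; apply: eq_bigr => j _.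
by rewrite pdotZl induced_metricE.
Qed.

Lemma pder_inj w (X Y : 'rV[R]_d) : W w -> h w \in unitmx ->
  (forall l, pdot t (pder X theta w) (D1 l w) = pdot t (pder Y theta w) (D1 l w)) ->
  X = Y.
Proof.
move=> Ww uh XY; apply: (row_free_inj (A := h w)); first by rewrite row_free_unit.
apply/rowP => l; rewrite !(mul_induced_metric _ _ Ww).
exact: XY.
Qed.

Section AlongMap.
Context {m : nat} (U : set 'rV[R]_m) (phi : 'rV[R]_m -> 'rV[R]_d).
Context (oU : open U) (phiW : forall u, U u -> W (phi u)).
Context (dphi : forall u, U u -> differentiable phi u).

(* d theta(V), a vector field of the flat space along theta \o phi. *)
Definition ambient (V : 'rV[R]_m -> 'rV[R]_d) (u : 'rV[R]_m) : 'rV[R]_n :=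
  pder (V u) theta (phi u).

Lemma ambientE V u : U u ->
  ambient V u = \sum_(e < d) V u 0 e *: D1 e (phi u).
Proof. by move=> Uu; rewrite /ambient (pder_coord _ (dT (phiW Uu))). Qed.

Let dD1 e u : U u -> differentiable (fun y => D1 e (phi y)) u.
Proof.
move=> Uu; apply: (differentiable_comp (dphi Uu)); exact: dT1 (phiW Uu).
Qed.

Lemma differentiable_ambient V u : U u -> differentiable V u ->
  differentiable (ambient V) u.
Proof.
move=> Uu dV.
apply: (differentiable_eq_on oU Uu (f := fun y => \sum_(e < d) V y 0 e *: D1 e (phi y))).
  by move=> y Uy; rewrite ambientE.
apply: differentiable_sumf => e; apply: differentiable_scale; last exact: dD1.
exact: differentiable_mxE.
Qed.

Lemma pder_ambient V X u : U u -> differentiable V u ->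
  pder X (ambient V) u = pder (pder X V u) theta (phi u) +
    \sum_(b < d) \sum_(e < d) (pder X phi u 0 b * V u 0 e) *: D2 b e (phi u).
Proof.
move=> Uu dV; have dVe e : differentiable (fun y => V y 0 e) u.
  exact: differentiable_mxE.
rewrite (pder_eq_on _ oU Uu (g := fun y => \sum_(e < d) V y 0 e *: D1 e (phi y))); last first.
  by move=> y Uy; rewrite ambientE.
rewrite pder_sumf => [|e]; last by apply: differentiable_scale => //; exact: dD1.
rewrite (pder_coord _ (dT (phiW Uu))) exchange_big -big_split /=.
apply: eq_bigr => e _; rewrite pder_scale//; last exact: dD1.
rewrite (pder_mxE _ _ _ dV); congr (_ + _).
rewrite pder_comp; [|exact: dphi|exact: dT1 (phiW Uu)].
rewrite (pder_coord _ (dT1 _ (phiW Uu))) scaler_sumr.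
by apply: eq_bigr => b _; rewrite scalerA mulrC.
Qed.

(* The Levi-Civita connection is the tangential part of flat differentiation. *)
Lemma levi_civita V (X : 'rV[R]_m -> 'rV[R]_m) u l :
  U u -> h (phi u) \in unitmx -> differentiable V u ->
  pdot t (ambient (nabla h phi X V) u) (D1 l (phi u)) =
  pdot t (pder (X u) (ambient V) u) (D1 l (phi u)).
Proof.
move=> Uu uh dV; have Wu := phiW Uu.
rewrite pder_ambient// /ambient /nabla -!pderE (pderDr _ _ (dT Wu)) !pdotDl.
congr (_ + _); rewrite (pder_coord (\row__ _) (dT Wu)) pdot_suml.
transitivity (\sum_a \sum_(b < d) \sum_(e < d) (pder (X u) phi u 0 b * V u 0 e) *
    (christoffel h (phi u) a b e * h (phi u) a l)).
  apply: eq_bigr => a _; rewrite pdotZl mxE -induced_metricE mulr_suml.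
  apply: eq_bigr => b _; rewrite mulr_suml; apply: eq_bigr => e _.
  by rewrite /dmap -pderE; ring.
rewrite exchange_big /= pdot_suml; apply: eq_bigr => b _.
rewrite exchange_big /= pdot_suml; apply: eq_bigr => e _.
by rewrite -mulr_sumr christoffel_lower// pdotZl.
Qed.

End AlongMap.
End InducedMetric.

(** * Gauss formula and curvature of the unit pseudosphere *)

Lemma pder_eq_cst {R : realType} {V W : normedModType R} (U : set V)
  (f : V -> W) a x v : open U -> U x -> (forall y, U y -> f y = a) -> pder v f x = 0.
Proof.
move=> oU Ux fa; rewrite (pder_eq_on v oU Ux (g := cst a))// pderE.
exact: derive_cst.
Qed.

Section UnitHypersurface.
Context {R : realType} {d : nat} (t : nat).
Context (W : set 'rV[R]_d) (theta : 'rV[R]_d -> 'rV[R]_d.+1).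
Context (oW : open W) (sT : smooth_on W theta).
Context (theta1 : forall w, W w -> pdot t (theta w) (theta w) = 1).
Context (rfT : forall w, W w -> row_free ('J theta w)).

Local Notation h := (induced_metric t theta).
Local Notation D1 i := (pder (coord_field i) theta).
Local Notation D2 i j := (pder (coord_field i) (pder (coord_field j) theta)).

Let dT w : W w -> differentiable theta w.
Proof. exact: smooth_differentiable. Qed.

Let dT1 v w : W w -> differentiable (pder v theta) w.
Proof. exact/smooth_differentiable/smooth_pder. Qed.

Lemma pdot_tangent_position w v : W w -> pdot t (pder v theta w) (theta w) = 0.
Proof.
move=> Ww; have := pder_eq_cst v oW Ww theta1.
rewrite (pder_pdot t v (dT Ww) (dT Ww)).
rewrite (pdotC _ (theta w)) -mulr2n => /eqP.
by rewrite mulrn_eq0 => /eqP.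
Qed.

(** Pairing a linear relation with the unit vector [theta w] kills its normal coefficient, and the
    Jacobian has full rank; so tangent vectors and position are independent and, by dimension,
    span. *)
Lemma tangent_normal_span w x : W w ->
  (forall l, pdot t x (D1 l w) = 0) -> pdot t x (theta w) = 0 -> x = 0.
Proof.
move=> Ww xD xT; apply: (@pdot_row_full _ _ t _ (col_mx ('J theta w) (theta w))).
  rewrite /row_full -[X in _ == X]addn1; apply: inj_row_free => v.
  rewrite -[v]hsubmxK mul_row_col; set v1 := lsubmx v; set v2 := rsubmx v.
  rewrite [v2]mx11_scalar mul_scalar_mx -(pder_jacobian _ (dT Ww)) => v0.
  have v20 : v2 0 0 = 0.
    have := congr1 (pdot t ^~ (theta w)) v0.
    by rewrite pdotDl pdotZl pdot_tangent_position// theta1// mulr1 add0r pdot0l.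
  move: v0; rewrite v20 scale0r addr0 (pder_jacobian _ (dT Ww)) => v10.
  have -> : v1 = 0.
    by apply: (row_free_inj (rfT Ww)); rewrite v10 mul0mx.
  by rewrite raddf0 row_mx0.
move=> i; case: (split_ordP i) => j ->.
  by rewrite rowKu rowE -(pder_jacobian _ (dT Ww)); exact: xD.
by rewrite rowKd row_id.
Qed.

(** A tangent vector orthogonal to all tangent vectors is also orthogonal to the position vector,
    hence zero. *)
Lemma induced_metric_unit w : W w -> h w \in unitmx.
Proof.
move=> Ww; rewrite -row_free_unit; apply: inj_row_free => Z Zh.
apply: (row_free_inj (rfT Ww)); rewrite mul0mx -(pder_jacobian _ (dT Ww)).
apply: (tangent_normal_span Ww) => [l|]; last exact: pdot_tangent_position.
by rewrite -(mul_induced_metric t sT _ _ Ww) Zh mxE.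
Qed.

Section AlongMap.
Context {m : nat} (U : set 'rV[R]_m) (phi : 'rV[R]_m -> 'rV[R]_d).
Context (oU : open U) (phiW : forall u, U u -> W (phi u)).
Context (dphi : forall u, U u -> differentiable phi u).

Local Notation amb := (ambient theta phi).

Lemma ambient_dmap X u : U u ->
  amb (dmap phi X) u = pder (X u) (fun y => theta (phi y)) u.
Proof.
by move=> Uu; rewrite pder_comp; [rewrite /ambient /dmap -pderE|exact: dphi|exact/dT/phiW].
Qed.

(** Differentiating the orthogonality of [amb V] and [theta] gives the normal component of the flat
    derivative; the added term removes it, and [levi_civita] identifies the tangential rest. *)
Lemma gauss_formula V X u : U u -> differentiable V u ->
  amb (nabla h phi X V) u =
  pder (X u) (amb V) u + pdot t (amb V u) (amb (dmap phi X) u) *: theta (phi u).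
Proof.
move=> Uu dV; have Wu := phiW Uu; have uh := induced_metric_unit Wu.
apply/eqP; rewrite -subr_eq0; apply/eqP; apply: (tangent_normal_span Wu) => [l|].
  rewrite pdotBl (levi_civita oW sT oU phiW dphi _ l Uu uh dV) pdotDl pdotZl.
  by rewrite (pdotC _ (theta _)) pdot_tangent_position// mulr0 addr0 subrr.
have perp y : U y -> pdot t (amb V y) (theta (phi y)) = 0.
  by move=> Uy; exact: pdot_tangent_position (phiW Uy).
have := pder_eq_cst (X u) oU Uu perp; rewrite pder_pdot; last first.
- by apply: (differentiable_comp (dphi Uu)); exact: dT.
- exact: (differentiable_ambient sT oU phiW dphi Uu dV).
rewrite -ambient_dmap// => E.
rewrite pdotBl pdotDl pdotZl theta1// mulr1 E subr0.
exact: pdot_tangent_position.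
Qed.

End AlongMap.

Let did w : W w -> differentiable (id : 'rV[R]_d -> 'rV[R]_d) w.
Proof. by move=> _; exact: ex_diff. Qed.

Local Notation V2 b k := (nabla h id (cst (coord_field b)) (cst (coord_field k))).

Lemma ambient_nabla_coord b k w : W w ->
  pder (V2 b k w) theta w = D2 b k w + h w b k *: theta w.
Proof.
move=> Ww; have dc : differentiable (cst (coord_field k) : 'rV[R]_d -> 'rV[R]_d) w.
  exact: differentiable_cst.
have := gauss_formula oW (fun _ H => H) did (cst (coord_field b)) Ww dc.
rewrite {1}/ambient /= => ->; congr (_ + _ *: _).
by rewrite induced_metricE pdotC /ambient /dmap derive_id.
Qed.

(** Required before the second covariant derivative in the curvature can be expanded. Regularity is
    read off the linear system for [V2 b k] instead of the Christoffel symbols. *)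
Lemma differentiable_nabla_coord b k w : W w -> differentiable (V2 b k) w.
Proof.
move=> Ww; apply: (@differentiable_solve _ _ _ W h (V2 b k)
  (fun y => \row_l pdot t (D2 b k y) (D1 l y)) w oW Ww induced_metric_unit).
- move=> y Wy; apply/rowP => l; rewrite (mul_induced_metric t sT _ _ Wy) mxE.
  rewrite ambient_nabla_coord// pdotDl pdotZl (pdotC _ (theta y)).
  by rewrite pdot_tangent_position// mulr0 addr0.
- exact: (differentiable_induced_metric t sT).
apply: differentiable_mxP => i l.
rewrite (_ : (fun _ => _) = fun y => pdot t (D2 b k y) (D1 l y)).
  apply: differentiable_pdot; last exact: dT1.
  exact: (smooth_differentiable (smooth_pder _ (smooth_pder _ sT)) Ww).
by apply/funext => y; rewrite mxE.
Qed.

(** The third derivatives of [theta] cancel by symmetry. There remains the derivative of the normal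
    term [h w b k *: theta w], whose tangential part comes from differentiating [theta] alone: the
    Gauss equation with curvature 1. *)
Lemma curvature_coord a b k w : W w ->
  nabla h id (cst (coord_field a)) (V2 b k) w -
  nabla h id (cst (coord_field b)) (V2 a k) w =
  h w b k *: coord_field a - h w a k *: coord_field b.
Proof.
move=> Ww; apply: (pder_inj sT Ww (induced_metric_unit Ww)) => l.
have amb2 a' b' : pdot t (pder (nabla h id (cst (coord_field a')) (V2 b' k) w) theta w)
    (D1 l w) = pdot t (pder (coord_field a') (D2 b' k) w) (D1 l w)
      + h w b' k * pdot t (D1 a' w) (D1 l w).
  have := levi_civita oW sT oW (fun _ H => H) did (cst (coord_field a')) l Ww
    (induced_metric_unit Ww) (differentiable_nabla_coord b' k Ww).
  rewrite {1}/ambient /= => ->.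
  rewrite (pder_eq_on _ oW Ww (g := fun y => D2 b' k y + h y b' k *: theta y)); last first.
    by move=> y Wy; rewrite /ambient ambient_nabla_coord.
  have dhh : differentiable (fun y => h y b' k) w.
    exact: (differentiable_mxE _ _ (differentiable_induced_metric t sT Ww)).
  rewrite pderDf; last 2 first.
  - exact: (smooth_differentiable (smooth_pder _ (smooth_pder _ sT)) Ww).
  - by apply: differentiable_scale => //; exact: dT.
  rewrite pder_scale//; last exact: dT.
  rewrite !pdotDl !pdotZl (pdotC _ (theta w)).
  by rewrite pdot_tangent_position// mulr0 add0r.
have ambB P Q x y : pdot t (pder P theta w) (D1 l w) = x ->
    pdot t (pder Q theta w) (D1 l w) = y ->
    pdot t (pder (P - Q) theta w) (D1 l w) = x - y.
  by move=> <- <-; rewrite -pdotBl -scaleN1r (pderDr _ _ (dT Ww)) (pderZr _ _ (dT Ww)) scaleN1r.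
apply: etrans (ambB _ _ _ _ (amb2 a b) (amb2 b a)) _.
rewrite (smooth_pder_symm (coord_field b) (coord_field a) oW Ww (smooth_pder _ sT)).
rewrite (ambB _ _ _ _ erefl erefl) !(pderZr _ _ (dT Ww)) !pdotZl.
by ring.
Qed.

Lemma curvatureE w X Y Z : W w ->
  curvature h w X Y Z = mdot (h w) Y Z *: X - mdot (h w) X Z *: Y.
Proof.
move=> Ww; rewrite /curvature.
transitivity (\sum_(a < d) \sum_(b < d) \sum_(k < d)
  ((Y 0 b * Z 0 k * h w b k) *: (X 0 a *: coord_field a)
   - (X 0 a * Z 0 k * h w a k) *: (Y 0 b *: coord_field b))).
  apply: eq_bigr => a _; apply: eq_bigr => b _; apply: eq_bigr => k _.
  rewrite curvature_coord// scalerBr !scalerA.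
  by congr (_ *: _ - _ *: _); ring.
have mE (P Q : 'rV[R]_d) : mdot (h w) P Q = \sum_(i < d) \sum_(j < d) P 0 i * Q 0 j * h w i j.
  by apply: eq_bigr => i _; apply: eq_bigr => j _; ring.
rewrite !mE {3}(row_sum_delta X) {4}(row_sum_delta Y).
rewrite scaler_sumr scaler_sumr.
under eq_bigr do under eq_bigr do rewrite sumrB -!scaler_suml.
under eq_bigr do rewrite sumrB -scaler_suml.
rewrite sumrB; congr (_ - _).
by rewrite exchange_big /=; apply: eq_bigr => b _; rewrite -scaler_suml.
Qed.

End UnitHypersurface.
(** * Tension fields of the small pseudosphere *)

Section SmallPseudosphere.
Context {R : realType} (m t : nat) (c : R).
Context (c1 : 1 <= c) (tm : (t <= m)%N).
Context (M : set 'rV[R]_m.+2) (U : set 'rV[R]_m) (psi : 'rV[R]_m -> 'rV[R]_m.+2).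
Context (W : set 'rV[R]_m.+1) (theta : 'rV[R]_m.+1 -> 'rV[R]_m.+2).
Context (phi : 'rV[R]_m -> 'rV[R]_m.+1).
Context (MS : M `<=` small_pseudosphere m t c).
Context (incl : local_inclusion M (pseudosphere m.+1 t 1) U psi W theta phi).

Local Notation g := (induced_metric t psi).
Local Notation h := (induced_metric t theta).
Local Notation b := (Num.sqrt (1 - c^-1)).
Local Notation pole := (delta_mx 0 ord_max : 'rV[R]_m.+2).
Local Notation amb := (ambient theta phi).

Let c0 : 0 < c. Proof. exact: lt_le_trans c1. Qed.
Let oU : open U. Proof. by have [[]] := incl. Qed.
Let sP : smooth_on U psi. Proof. by have [[]] := incl. Qed.
Let oW : open W. Proof. by have [_ []] := incl. Qed.
Let sT : smooth_on W theta. Proof. by have [_ []] := incl. Qed.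
Let sphi : smooth_on U phi. Proof. by have [] := incl. Qed.

Let rfP u : U u -> row_free ('J psi u).
Proof. by have [[_ _ _ _ rf] _ _ _ _] := incl; exact: rf. Qed.

Let rfT w : W w -> row_free ('J theta w).
Proof. by have [_ [_ _ _ _ rf] _ _ _] := incl; exact: rf. Qed.

Let phiW u : U u -> W (phi u).
Proof. by move=> Uu; have [_ _ _ Wphi _] := incl; apply: Wphi; exists u. Qed.

Let thetaphi u : U u -> theta (phi u) = psi u.
Proof. by have [_ _ _ _ tp] := incl; exact: tp. Qed.

Let theta1 w : W w -> pdot t (theta w) (theta w) = 1.
Proof.
move=> Ww; have [_ [_ _ _ TN _] _ _ _] := incl.
have : pseudosphere m.+1 t 1 (theta w) by apply: TN; exists w.
by rewrite /pseudosphere /= invr1.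
Qed.

Let psiM u : U u -> small_pseudosphere m t c (psi u).
Proof. by move=> Uu; have [[_ _ _ PM _] _ _ _ _] := incl; apply/MS/PM; exists u. Qed.

Let dP u : U u -> differentiable psi u. Proof. exact: smooth_differentiable. Qed.
Let dT w : W w -> differentiable theta w. Proof. exact: smooth_differentiable. Qed.
Let dphi u : U u -> differentiable phi u. Proof. exact: smooth_differentiable. Qed.

Let did u : U u -> differentiable (id : 'rV[R]_m -> 'rV[R]_m) u.
Proof. by move=> _; exact: ex_diff. Qed.

Lemma height_sqr : b ^+ 2 = 1 - c^-1.
Proof. by rewrite sqr_sqrtr// subr_ge0 invf_le1. Qed.

Lemma pdot_pole (x : 'rV[R]_m.+2) : pdot t pole x = x 0 ord_max.
Proof. by rewrite pdot_deltal /psign /= ltnNge (leqW tm) mul1r. Qed.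

Let psi1 u : U u -> pdot t (psi u) (psi u) = 1.
Proof. by move=> /psiM[/= + _]; rewrite /pseudosphere /= invr1. Qed.

Let psi_pole u : U u -> pdot t pole (psi u) = b.
Proof. by move=> /psiM[_ /=]; rewrite pdot_pole. Qed.

Let pole1 : pdot t pole pole = 1.
Proof. by rewrite pdot_pole mxE !eqxx. Qed.

Let pder_pole X u : U u -> pder X (cst pole) u = 0.
Proof. by move=> Uu; exact: (pder_eq_cst X oU Uu (fun _ _ => erefl)). Qed.

Let pder_psi_perp X u : U u -> pdot t (pder X psi u) (psi u) = 0.
Proof.
move=> Uu; have := pder_eq_cst X oU Uu psi1.
rewrite (pder_pdot t X (dP Uu) (dP Uu)) (pdotC _ (psi u)) -mulr2n => /eqP.
by rewrite mulrn_eq0 => /eqP.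
Qed.

Let pder_psi_pole X u : U u -> pdot t (pder X psi u) pole = 0.
Proof.
move=> Uu; have := pder_eq_cst X oU Uu psi_pole.
rewrite (pder_pdot t X (differentiable_cst pole u) (dP Uu)) pderE derive_cst pdot0l add0r.
by rewrite pdotC.
Qed.

(** Position and pole are both orthogonal to the tangent vectors of M, and their Gram determinant
    [1 - b ^+ 2] is [c^-1], so the three families together span. *)
Lemma psi_frame_span x u : U u -> (forall l, pdot t x (pder (coord_field l) psi u) = 0) ->
  pdot t x (psi u) = 0 -> pdot t x pole = 0 -> x = 0.
Proof.
move=> Uu xD xP xn.
apply: (@pdot_row_full _ _ t _ (col_mx (col_mx ('J psi u) (psi u)) pole)).
  rewrite /row_full -[X in _ == X](_ : m + 1 + 1 = _)%N; last by rewrite !addn1.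
  apply: inj_row_free => v.
  rewrite -[v]hsubmxK mul_row_col; set v12 := lsubmx v; set v3 := rsubmx v.
  rewrite -[v12]hsubmxK mul_row_col; set v1 := lsubmx v12; set v2 := rsubmx v12.
  rewrite [v2]mx11_scalar [v3]mx11_scalar !mul_scalar_mx -(pder_jacobian _ (dP Uu)) => v0.
  have e1 := congr1 (pdot t ^~ (psi u)) v0.
  have e2 := congr1 (pdot t ^~ pole) v0.
  rewrite pdot0l !pdotDl !pdotZl pder_psi_perp// psi1// psi_pole// in e1.
  rewrite pdot0l !pdotDl !pdotZl pder_psi_pole// pole1 (pdotC _ (psi u)) psi_pole// in e2.
  (* The relation obtained from the pole minus [b] times the one obtained from [psi u] isolates
     [v3 0 0]. *)
  have v30 : v3 0 0 = 0.
    have : v3 0 0 * (1 - b ^+ 2) =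
      0 + v2 0 0 * b + v3 0 0 * 1 - b * (0 + v2 0 0 * 1 + v3 0 0 * b) by ring.
    rewrite e1 e2 mulr0 subr0.
    rewrite height_sqr opprB addrCA subrr addr0 => /eqP.
    by rewrite mulf_eq0 invr_eq0 (gt_eqF c0) orbF => /eqP.
  have v20 : v2 0 0 = 0 by move: e1; rewrite v30 mul0r addr0 mulr1 add0r.
  move: v0; rewrite v20 v30 !scale0r !addr0 (pder_jacobian _ (dP Uu)) => v10.
  have -> : v1 = 0 by apply: (row_free_inj (rfP Uu)); rewrite v10 mul0mx.
  by rewrite !raddf0 !row_mx0.
move=> i; case: (split_ordP i) => j ->; last by rewrite rowKd row_id.
rewrite rowKu; case: (split_ordP j) => k ->; last by rewrite rowKd row_id.
by rewrite rowKu rowE -(pder_jacobian _ (dP Uu)); exact: xD.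
Qed.

Lemma small_metric_unit u : U u -> g u \in unitmx.
Proof.
move=> Uu; rewrite -row_free_unit; apply: inj_row_free => Z Zg.
apply: (row_free_inj (rfP Uu)); rewrite mul0mx -(pder_jacobian _ (dP Uu)).
apply: (psi_frame_span Uu) => [l||]; [|exact: pder_psi_perp|exact: pder_psi_pole].
by rewrite -(mul_induced_metric t sP _ _ Uu) Zg mxE.
Qed.

Let amb_inj u X Y : U u -> pder X theta (phi u) = pder Y theta (phi u) -> X = Y.
Proof.
move=> Uu; rewrite !(pder_jacobian _ (dT (phiW Uu))).
exact: (row_free_inj (rfT (phiW Uu))).
Qed.

Let amb_dmap X u : U u -> amb (dmap phi X) u = pder (X u) psi u.
Proof.
move=> Uu; rewrite (ambient_dmap sT phiW dphi _ Uu).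
exact: (pder_eq_on _ oU Uu thetaphi).
Qed.

(* Ambient normal field of M in N; its square length is c^-1, not 1. *)
Definition ambient_normal (u : 'rV[R]_m) : 'rV[R]_m.+2 := pole - b *: psi u.
Local Notation nuA := ambient_normal.

(** The field [nuA] in the chart of N: its products with the coordinate tangent vectors, raised by
    the inverse metric. *)
Definition normal_field (u : 'rV[R]_m) : 'rV[R]_m.+1 :=
  (\row_l pdot t (nuA u) (pder (coord_field l) theta (phi u))) *m invmx (h (phi u)).
Local Notation nu := normal_field.

Let nuA_psi u : U u -> pdot t (nuA u) (psi u) = 0.
Proof. by move=> Uu; rewrite pdotBl pdotZl psi1// psi_pole// mulr1 subrr. Qed.

Let nuA_pder X u : U u -> pdot t (nuA u) (pder X psi u) = 0.
Proof.
move=> Uu; rewrite pdotBl pdotZl !(pdotC _ _ (pder X psi u)).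
by rewrite pder_psi_pole// pder_psi_perp// mulr0 subr0.
Qed.

Let nuA_pole u : U u -> pdot t (nuA u) pole = c^-1.
Proof.
move=> Uu; rewrite pdotBl pdotZl pole1 (pdotC _ (psi u)) psi_pole//.
by rewrite -expr2 height_sqr opprB addrCA subrr addr0.
Qed.

Let nuA_nuA u : U u -> pdot t (nuA u) (nuA u) = c^-1.
Proof.
by move=> Uu; rewrite {2}/nuA pdotBr pdotZr nuA_psi// mulr0 subr0 nuA_pole.
Qed.

Let dnuA u : U u -> differentiable nuA u.
Proof.
move=> Uu; apply: differentiableB; first exact: differentiable_cst.
by apply: differentiableZ; exact: dP.
Qed.

Let pder_nuA X u : U u -> pder X nuA u = - b *: pder X psi u.
Proof.
move=> Uu; rewrite (_ : nuA = fun y => pole + - b *: psi y); last first.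
  by apply/funext => y; rewrite scaleNr.
rewrite pderDf; [|exact: differentiable_cst|by apply: differentiableZ; exact: dP].
by rewrite (pderZf _ _ (dP Uu)) (pder_pole X Uu) add0r.
Qed.

(** Since [nuA] is orthogonal to the position vector it is tangent to N, so its chart components
    lose nothing. *)
Lemma ambient_normal_field u : U u -> amb nu u = nuA u.
Proof.
move=> Uu; have Wu := phiW Uu; have uh := induced_metric_unit oW sT theta1 rfT Wu.
apply/eqP; rewrite -subr_eq0; apply/eqP.
apply: (tangent_normal_span oW sT theta1 rfT Wu) => [l|].
  by rewrite pdotBl -(mul_induced_metric t sT _ _ Wu) mulmxKV// mxE subrr.
rewrite pdotBl (pdot_tangent_position oW sT theta1 _ Wu) thetaphi// nuA_psi//.
by rewrite subrr.
Qed.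

Lemma differentiable_normal_field u : U u -> differentiable nu u.
Proof.
move=> Uu; have Wu := phiW Uu; apply: differentiable_mulmx.
  apply: differentiable_mxP => i l.
  rewrite (_ : (fun _ => _) = fun y => pdot t (nuA y) (pder (coord_field l) theta (phi y))).
    apply: differentiable_pdot; first exact: dnuA.
    apply: (differentiable_comp (dphi Uu)).
    exact: (smooth_differentiable (smooth_pder _ sT) Wu).
  by apply/funext => y; rewrite mxE.
apply: (@differentiable_invmx _ _ _ U (fun y => h (phi y)) u oU Uu).
  by move=> y Uy; exact: (induced_metric_unit oW sT theta1 rfT (phiW Uy)).
apply: (differentiable_comp (dphi Uu)).
exact: (differentiable_induced_metric t sT Wu).
Qed.

(** The Gauss correction vanishes because [nuA] is orthogonal to M. The coefficient [f] is only
    required to be stationary along [X u], which covers constant multiples as well as the unit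
    normal, whose coefficient is not constant by construction. *)
Lemma nabla_normal (V : 'rV[R]_m -> 'rV[R]_m.+1) (f : 'rV[R]_m -> R) X u : U u ->
  differentiable V u -> differentiable f u -> pder (X u) f u = 0 ->
  (forall y, U y -> amb V y = f y *: nuA y) ->
  nabla h phi X V u = - (f u * b) *: dmap phi X u.
Proof.
move=> Uu dV df f0 Vf; apply: (amb_inj Uu).
rewrite (pderZr _ _ (dT (phiW Uu))).
rewrite -[LHS]/(amb (nabla h phi X V) u) -[X in _ = _ *: X]/(amb (dmap phi X) u).
rewrite (gauss_formula oW sT theta1 rfT oU phiW dphi X Uu dV) amb_dmap// Vf//.
rewrite pdotZl nuA_pder// mulr0 scale0r addr0.
rewrite (pder_eq_on _ oU Uu Vf) (pder_scale _ df (dnuA Uu)).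
by rewrite f0 scale0r add0r pder_nuA// scalerA mulrN.
Qed.

Let differentiable_dmap (X : 'rV[R]_m -> 'rV[R]_m) u : U u ->
  differentiable X u -> differentiable (dmap phi X) u.
Proof.
move=> Uu dX.
rewrite (_ : dmap phi X = ambient phi id X); last first.
  by apply/funext => y; rewrite /dmap /ambient pderE.
exact: (differentiable_ambient sphi oU (fun _ H => H) did Uu dX).
Qed.

(** Tangent fields of M stay orthogonal to the pole, so the pole component of the left side comes
    from the Gauss term alone and equals [b] times the product of [X] and [Y]. Division by the pole
    component [c^-1] of [nuA] produces [b * c]. *)
Lemma second_fundamental_form (X Y : 'rV[R]_m -> 'rV[R]_m) u : U u ->
  (forall y, U y -> differentiable Y y) ->
  nabla h phi X (dmap phi Y) u - dmap phi (nabla g id X Y) u =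
  (b * c * mdot (g u) (X u) (Y u)) *: nu u.
Proof.
move=> Uu dY; have Wu := phiW Uu; apply: (amb_inj Uu).
have dTu := dT Wu.
rewrite -scaleN1r (pderDr _ _ dTu) !(pderZr _ _ dTu).
rewrite -[X in X + _]/(amb (nabla h phi X (dmap phi Y)) u).
rewrite -[X in _ + -1 *: X]/(amb (dmap phi (nabla g id X Y)) u).
rewrite -[X in _ = _ *: X]/(amb nu u) ambient_normal_field// amb_dmap//.
rewrite (gauss_formula oW sT theta1 rfT oU phiW dphi X Uu
          (differentiable_dmap Uu (dY u Uu))).
rewrite thetaphi// !amb_dmap// (mdot_induced t sP _ _ Uu).
have aE y : U y -> amb (dmap phi Y) y = ambient psi id Y y.
  by move=> Uy; rewrite amb_dmap.
rewrite (pder_eq_on _ oU Uu aE).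
have dA := differentiable_ambient sP oU (fun _ H => H) did Uu (dY u Uu).
have A_pole : pdot t (pder (X u) (ambient psi id Y) u) pole = 0.
  have A0 y : U y -> pdot t (ambient psi id Y y) pole = 0.
    by move=> Uy; rewrite pder_psi_pole.
  have := pder_eq_cst (X u) oU Uu A0.
  rewrite (pder_pdot t (X u) dA (differentiable_cst pole u)).
  by rewrite pder_pole// pdot0r addr0.
have A_psi : pdot t (pder (X u) (ambient psi id Y) u) (psi u) =
    - pdot t (pder (X u) psi u) (pder (Y u) psi u).
  have A0 y : U y -> pdot t (ambient psi id Y y) (psi y) = 0.
    by move=> Uy; rewrite pder_psi_perp.
  have := pder_eq_cst (X u) oU Uu A0.
  rewrite (pder_pdot t (X u) dA (dP Uu)) => /eqP; rewrite addr_eq0 => /eqP ->.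
  by rewrite (pdotC t (pder (X u) psi u)).
have LC l : pdot t (pder (nabla g id X Y u) psi u) (pder (coord_field l) psi u) =
    pdot t (pder (X u) (ambient psi id Y) u) (pder (coord_field l) psi u).
  exact: (levi_civita oU sP oU (fun _ H => H) did X l Uu (small_metric_unit Uu) (dY u Uu)).
apply/eqP; rewrite -subr_eq0; apply/eqP.
apply: (psi_frame_span Uu) => [l||].
- rewrite pdotBl !pdotDl !pdotZl LC (pdotC _ (psi u)) pder_psi_perp// nuA_pder//.
  by rewrite !mulr0 addr0 mulN1r !subr0 subrr.
- rewrite pdotBl !pdotDl !pdotZl A_psi psi1// nuA_psi// pder_psi_perp// (pdotC _ (pder (Y u) psi u)).
  by ring.
rewrite pdotBl !pdotDl !pdotZl A_pole (pdotC _ (psi u)) psi_pole// nuA_pole//.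
rewrite pder_psi_pole// (pdotC _ (pder (Y u) psi u)).
by field; rewrite gt_eqF.
Qed.

Context (e : 'I_m -> 'rV[R]_m -> 'rV[R]_m) (eps : 'I_m -> R).
Context (frame : orthonormal_frame g U e eps).

Let de i u : U u -> differentiable (e i) u.
Proof. by have [se _ _] := frame; exact: smooth_differentiable. Qed.

Let eps_sqr i : eps i * eps i = 1.
Proof. by have [_ + _] := frame => /(_ i)[->|->]; rewrite ?mulr1// mulrNN mulr1. Qed.

Let ee i u : U u -> mdot (g u) (e i u) (e i u) = eps i.
Proof. by have [_ _ +] := frame => H /H ->; rewrite eqxx. Qed.

Local Notation mu := (m%:R * b * c).
Local Notation lam := (m%:R * b ^+ 2 * c).

Let sum_eps (k : R) (v : 'rV[R]_m.+1) :
  \sum_(i < m) eps i *: ((k * eps i) *: v) = (m%:R * k) *: v.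
Proof.
rewrite (eq_bigr (fun=> k *: v)) => [|i _].
  by rewrite sumr_const card_ord -scaler_nat scalerA.
by rewrite scalerA mulrCA eps_sqr mulr1.
Qed.

Lemma tension_normal u : U u -> tension g h phi e eps u = mu *: nu u.
Proof.
move=> Uu; rewrite -mulrA -sum_eps /tension; apply: eq_bigr => i _.
rewrite second_fundamental_form// => [|y Uy]; last exact: de.
by rewrite ee.
Qed.

Let nabla_eq_on X (F G : 'rV[R]_m -> 'rV[R]_m.+1) u : U u ->
  (forall y, U y -> F y = G y) -> nabla h phi X F u = nabla h phi X G u.
Proof.
by move=> Uu FG; rewrite /nabla -!(pderE (X u)) (pder_eq_on _ oU Uu FG) FG.
Qed.

Let nablaZ X (k : R) (G : 'rV[R]_m -> 'rV[R]_m.+1) u : differentiable G u ->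
  nabla h phi X (fun y => k *: G y) u = k *: nabla h phi X G u.
Proof.
move=> dG; rewrite /nabla -!(pderE (X u)) (pderZf _ _ dG) scalerDr; congr (_ + _).
apply/rowP => a; rewrite !mxE mulr_sumr; apply: eq_bigr => i _.
by rewrite mulr_sumr; apply: eq_bigr => j _; rewrite mxE; ring.
Qed.

Let nabla_multiple k (V : 'rV[R]_m -> 'rV[R]_m.+1) X u : U u ->
  (forall y, U y -> V y = k *: nu y) ->
  nabla h phi X V u = - (k * b) *: dmap phi X u.
Proof.
move=> Uu VE; apply: (@nabla_normal V (fun=> k) _ _ Uu).
- apply: (differentiable_eq_on oU Uu (f := fun y => k *: nu y)) => [y /VE -> //|].
  by apply: differentiableZ; exact: differentiable_normal_field.
- exact: differentiable_cst.
- exact: (pder_eq_cst _ oU Uu (fun _ _ => erefl)).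
move=> y Uy; rewrite /ambient VE// (pderZr _ _ (dT (phiW Uy))); congr (_ *: _).
exact: ambient_normal_field.
Qed.

(** Differentiating [k *: nu] gives [- (k * b)] times [dmap phi], so the Laplacian reassembles
    [k * b] times the tension field; the eigenvalue is therefore [b * mu], which is [lam]. *)
Lemma rough_laplacian_multiple k (V : 'rV[R]_m -> 'rV[R]_m.+1) u : U u ->
  (forall y, U y -> V y = k *: nu y) ->
  rough_laplacian g h phi e eps V u = (k * lam) *: nu u.
Proof.
move=> Uu VE; rewrite /rough_laplacian.
rewrite (_ : \sum_(i < m) _ = - (k * b) *: tension g h phi e eps u).
  by rewrite tension_normal// scaleNr opprK scalerA; congr (_ *: _); ring.
rewrite /tension scaler_sumr; apply: eq_bigr => i _.
rewrite scalerA mulrC -scalerA; congr (_ *: _); rewrite scalerBr.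
rewrite (nabla_multiple _ Uu VE); congr (_ - _).
rewrite (nabla_eq_on _ Uu (G := fun y => - (k * b) *: dmap phi (e i) y)).
  by rewrite nablaZ//; exact: (differentiable_dmap Uu (de i Uu)).
by move=> y Uy; exact: (nabla_multiple _ Uy VE).
Qed.

Lemma lap_tension_normal k u : U u ->
  lap_tension g h phi e eps k u = (mu * lam ^+ k) *: nu u.
Proof.
elim: k u => [|k IHk] u Uu; first by rewrite expr0 mulr1; exact: tension_normal.
by rewrite exprSr mulrA; exact: rough_laplacian_multiple.
Qed.

Lemma nabla_lap_tension k X u : U u ->
  nabla h phi X (lap_tension g h phi e eps k) u =
  - (mu * lam ^+ k * b) *: dmap phi X u.
Proof. by move=> Uu; apply: nabla_multiple => // y; exact: lap_tension_normal. Qed.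

Let mdot_comb (w X Y Z : 'rV[R]_m.+1) (p q : R) : W w ->
  mdot (h w) (p *: X + q *: Y) Z = p * mdot (h w) X Z + q * mdot (h w) Y Z.
Proof.
move=> Ww; rewrite !(mdot_induced t sT _ _ Ww) (pderDr _ _ (dT Ww)).
by rewrite !(pderZr _ _ (dT Ww)) pdotDl !pdotZl.
Qed.

(** Constant curvature turns the curvature term at [e i] into [eps i] times [q' V - q V']. The
    tangential parts cancel and a 2 by 2 determinant of coefficients is left on [nu]. *)
Lemma curv_trace_normal (V V' : 'I_m -> 'rV[R]_m -> 'rV[R]_m.+1) (p q p' q' : R) u :
  U u -> (forall i, V i u = p *: nu u + q *: dmap phi (e i) u) ->
  (forall i, V' i u = p' *: nu u + q' *: dmap phi (e i) u) ->
  curv_trace h phi e eps V V' u = (m%:R * (p * q' - p' * q)) *: nu u.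
Proof.
move=> Uu VE V'E; rewrite -sum_eps /curv_trace; apply: eq_bigr => i _.
congr (_ *: _); have Wu := phiW Uu.
have TT : mdot (h (phi u)) (dmap phi (e i) u) (dmap phi (e i) u) = eps i.
  rewrite (mdot_induced t sT _ _ Wu) -/(amb (dmap phi (e i)) u) amb_dmap//.
  by rewrite -(mdot_induced t sP _ _ Uu) ee.
have nT : mdot (h (phi u)) (nu u) (dmap phi (e i) u) = 0.
  rewrite (mdot_induced t sT _ _ Wu) -/(amb nu u) -/(amb (dmap phi (e i)) u).
  by rewrite amb_dmap// ambient_normal_field// nuA_pder.
rewrite (curvatureE oW sT theta1 rfT)// VE V'E !mdot_comb// TT nT !mulr0 !add0r.
rewrite !scalerDr !scalerA opprD addrACA -!scalerBl.
rewrite (_ : q' * eps i * q - _ = 0) ?scale0r ?addr0; last by ring.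
by congr (_ *: _); ring.
Qed.

(** Every curvature term contributes [m * mu * lam ^+ (r - 2)]. With s the half of r, there is one
    from the trace against [dmap phi], two for each of the s - 1 summands, and one more when r is
    odd: r - 1 in both cases. *)
Lemma r_tension_normal r u : (3 <= r)%N -> U u ->
  r_tension g h phi e eps r u =
  (mu * lam ^+ (r - 2) * (lam - m%:R * (r.-1)%:R)) *: nu u.
Proof.
move=> r3 Uu.
pose L k := mu * lam ^+ k.
have LE k i : lap_tension g h phi e eps k u = L k *: nu u + 0 *: dmap phi (e i) u.
  by rewrite scale0r addr0 lap_tension_normal.
have NE k i : nabla h phi (e i) (lap_tension g h phi e eps k) u =
    0 *: nu u + - (L k * b) *: dmap phi (e i) u.
  by rewrite scale0r add0r nabla_lap_tension.
have TE i : dmap phi (e i) u = 0 *: nu u + 1 *: dmap phi (e i) u.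
  by rewrite scale0r add0r scale1r.
have t1 k : curv_trace h phi e eps (fun=> lap_tension g h phi e eps k)
    (fun i => dmap phi (e i)) u = (m%:R * L k) *: nu u.
  rewrite (curv_trace_normal Uu (LE k) TE); congr (_ *: _); ring.
have t2 k l : curv_trace h phi e eps
    (fun i => nabla h phi (e i) (lap_tension g h phi e eps k))
    (fun=> lap_tension g h phi e eps l) u = (m%:R * (L k * L l * b)) *: nu u.
  by rewrite (curv_trace_normal Uu (NE k) (LE l)); congr (_ *: _); ring.
have t3 k l : curv_trace h phi e eps (fun=> lap_tension g h phi e eps k)
    (fun i => nabla h phi (e i) (lap_tension g h phi e eps l)) u =
    - (m%:R * (L k * L l * b)) *: nu u.
  by rewrite (curv_trace_normal Uu (LE k) (NE l)); congr (_ *: _); ring.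
(* As [mu * b = lam], the two factors [mu] merge into one and the exponent rises by one. *)
have LL k l : m%:R * (L k * L l * b) = m%:R * L (k + l).+1.
  by rewrite /L (exprSr _ (k + l)) exprD; ring.
(* In the range [1 <= l < s] the subtractions in the two orders do not truncate, and the orders add
   up to a number independent of [l]: 2s - 3 for even r, 2s - 2 for odd r. *)
have sumE k s : (forall l, (1 <= l < s)%N -> (k l).1 + (k l).2 = (2 * s + odd r - 3)%N) ->
  \sum_(1 <= l < s)
    (curv_trace h phi e eps (fun i => nabla h phi (e i) (lap_tension g h phi e eps (k l).1))
       (fun=> lap_tension g h phi e eps (k l).2) u
     - curv_trace h phi e eps (fun=> lap_tension g h phi e eps (k l).1)
       (fun i => nabla h phi (e i) (lap_tension g h phi e eps (k l).2)) u) =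
  (2 * (s.-1)%:R * m%:R * L (2 * s + odd r - 3).+1) *: nu u.
  move=> kE; rewrite big_nat_cond.
  rewrite (eq_bigr (fun=> (2 * m%:R * L (2 * s + odd r - 3).+1) *: nu u)) => [|l].
    rewrite -big_nat_cond big_const_nat iter_addr_0 subn1 -scaler_nat scalerA.
    by congr (_ *: _); ring.
  rewrite andbT => /kE <-; rewrite t2 t3 -scalerBl LL; congr (_ *: _); ring.
have rE := odd_double_half r; rewrite -mul2n in rE.
rewrite /r_tension; case: ifP => ro; rewrite ro in rE sumE.
  case: r./2 rE sumE => [|s] rE sumE; first by lia.
  rewrite /tension_odd lap_tension_normal// t1 t2 LL.
  rewrite (sumE (fun l => (s.+1 + l - 1, s.+1 - l - 1)%N)) => [|l /= ls]; last by lia.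
  rewrite -!scalerBl; congr (_ *: _).
  have -> : r.-1 = (2 * s + 2)%N by lia.
  have -> : (r - 2)%N = (2 * s + 1)%N by lia.
  have -> : (2 * s.+1 + true - 3).+1 = (2 * s + 1)%N by lia.
  have -> : (s.+1 - 1 + (s.+1 - 1)).+1 = (2 * s + 1)%N by lia.
  have -> : (2 * s.+1 - 1)%N = (2 * s + 1)%N by lia.
  have -> : (2 * s.+1)%N = (2 * s + 1).+1 by lia.
  by rewrite /L (exprS _ (2 * s + 1)%N) (natrD _ (2 * s)%N 2) (natrM _ 2 s) /=; ring.
case: r./2 rE sumE => [|s] rE sumE; first by lia.
rewrite /tension_even lap_tension_normal// t1.
rewrite (sumE (fun l => (s.+1 + l - 2, s.+1 - l - 1)%N)) => [|l /= ls]; last by lia.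
rewrite -!scalerBl; congr (_ *: _).
have -> : r.-1 = (2 * s + 1)%N by lia.
have -> : (r - 2)%N = (2 * s)%N by lia.
have -> : (2 * s.+1 + false - 3).+1 = (2 * s)%N by lia.
have -> : (2 * s.+1 - 2)%N = (2 * s)%N by lia.
have -> : (2 * s.+1 - 1)%N = (2 * s).+1 by lia.
by rewrite /L (exprS _ (2 * s)%N) (natrD _ (2 * s)%N 1) (natrM _ 2 s) /=; ring.
Qed.

Lemma normal_field_neq0 u : U u -> nu u != 0.
Proof.
move=> Uu; apply/negP => /eqP n0.
have := nuA_nuA Uu; rewrite -(ambient_normal_field Uu) /ambient n0.
rewrite -[0 : 'rV[R]_m.+1](scale0r 0) (pderZr _ _ (dT (phiW Uu))) scale0r pdot0l.
by move/esym/eqP; rewrite invr_eq0 gt_eqF.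
Qed.

(** * Shape operator and mean curvature *)

Section UnitNormal.
Context (eta : 'rV[R]_m -> 'rV[R]_m.+1) (eps0 : R).
Context (etaN : unit_normal h U phi eta eps0).

(** The coefficient of [eta] along [nuA]; the factor [c] compensates for the square length [c^-1] of
    [nuA]. *)
Definition normal_factor (u : 'rV[R]_m) : R := c * pdot t (amb eta u) (nuA u).

Let deta u : U u -> differentiable eta u.
Proof. by have [se _ _ _] := etaN; exact: smooth_differentiable. Qed.

Let amb_eta u : U u -> amb eta u = normal_factor u *: nuA u.
Proof.
move=> Uu; have Wu := phiW Uu.
have etaP : pdot t (amb eta u) (psi u) = 0.
  by rewrite -thetaphi//; exact: (pdot_tangent_position oW sT theta1 _ Wu).
apply/eqP; rewrite -subr_eq0; apply/eqP; apply: (psi_frame_span Uu) => [l||].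
- rewrite pdotBl pdotZl nuA_pder// mulr0 subr0.
  have [_ _ _ /(_ u Uu (coord_field l))] := etaN.
  rewrite (mdot_induced t sT _ _ Wu) => E; rewrite -[RHS]E; congr (pdot t _ _).
  by rewrite -(amb_dmap (cst (coord_field l)) Uu).
- by rewrite pdotBl pdotZl nuA_psi// mulr0 subr0.
rewrite pdotBl pdotZl nuA_pole// /normal_factor /nuA pdotBr pdotZr etaP.
by field; rewrite gt_eqF.
Qed.

Lemma normal_factor_sqr u : U u -> normal_factor u ^+ 2 = c * eps0.
Proof.
move=> Uu; have [_ _ /(_ u Uu) <- _] := etaN.
rewrite (mdot_induced t sT _ _ (phiW Uu)) -/(amb eta u) amb_eta//.
by rewrite pdotZl pdotZr nuA_nuA//; field; rewrite gt_eqF.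
Qed.

Lemma normal_factor_neq0 u : U u -> normal_factor u != 0.
Proof.
move=> Uu; rewrite -sqrf_eq0 normal_factor_sqr// mulf_neq0//; first by rewrite gt_eqF.
by have [_ [->|->] _ _] := etaN; rewrite ?oppr_eq0 oner_eq0.
Qed.

(** The square of [normal_factor] is the nonzero constant [c * eps0], so the product rule forces the
    derivative of [normal_factor] to vanish. *)
Lemma nabla_unit_normal X u : U u ->
  nabla h phi X eta u = - (normal_factor u * b) *: dmap phi X u.
Proof.
move=> Uu.
have dk : differentiable normal_factor u.
  apply: differentiableZ; apply: differentiable_pdot; last exact: dnuA.
  exact: (differentiable_ambient sT oU phiW dphi Uu (deta Uu)).
apply: (nabla_normal Uu (deta Uu) dk) => [|y Uy]; last exact: amb_eta.
have := pder_eq_cst (X u) oU Uu normal_factor_sqr.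
rewrite (_ : (fun _ => _) = fun y => normal_factor y * normal_factor y) //.
rewrite (pderMf _ dk dk) -mulr2n => /eqP.
by rewrite mulrn_eq0 mulf_eq0 (negbTE (normal_factor_neq0 Uu)) => /eqP.
Qed.

Lemma shape_operator_scalar :
  shape_operator h U phi eta (fun u => (normal_factor u * b)%:M).
Proof.
move=> u Uu X; rewrite nabla_unit_normal// mul_mx_scalar scaleNr opprK.
by rewrite -pderE (pderZr _ _ (dphi Uu)) /dmap pderE.
Qed.

(** An immersion admits at most one solution of the defining relation, so every admissible [A] is
    the scalar one. *)
Lemma shape_operatorE A u : shape_operator h U phi eta A -> U u ->
  A u = (normal_factor u * b)%:M.
Proof.
move=> HA Uu; apply/row_matrixP => i; rewrite !rowE.
apply: (row_free_inj (rfP Uu)); rewrite -!(pder_jacobian _ (dP Uu)).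
have AE B : shape_operator h U phi eta B ->
    pder (coord_field i *m B u) psi u = amb (fun y => - nabla h phi (cst (coord_field i)) eta y) u.
  by move=> HB; rewrite -(amb_dmap (fun y => coord_field i *m B y) Uu) /ambient /dmap HB.
by rewrite (AE _ HA) (AE _ shape_operator_scalar).
Qed.

Lemma mean_curvature_scalar A u : (0 < m)%N -> shape_operator h U phi eta A ->
  U u -> mean_curvature eps0 A u = eps0 * normal_factor u * b.
Proof.
move=> m0 HA Uu; rewrite /mean_curvature (shape_operatorE HA Uu) mxtrace_scalar.
by rewrite -mulr_natr; field; rewrite pnatr_eq0 -lt0n.
Qed.

End UnitNormal.
End SmallPseudosphere.

(** * Iterated differentiability of scalar functions *)

Section IteratedDifferentiability.
Context {R : realType} {m : nat} (U : set 'rV[R]_m) (oU : open U).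
Implicit Types f g : 'rV[R]_m -> R.

(** A scalar counterpart of [Ck_on] with no condition at order 0, which makes closure under the
    field operations a plain induction. The continuity asked by [Ck_on] is paid for with one extra
    order in [smooth_coord]. *)
Fixpoint diffn (k : nat) f : Prop :=
  if k is k'.+1 then
    (forall u, U u -> differentiable f u) /\ (forall v, diffn k' (pder v f))
  else True.

Lemma diffn_eq k f g : (forall u, U u -> f u = g u) -> diffn k f -> diffn k g.
Proof.
elim: k f g => [//|k IHk] f g fg [df Df]; split=> [u Uu|v].
  exact: (differentiable_eq_on oU Uu fg (df u Uu)).
by apply: IHk (Df v) => u Uu; exact: (pder_eq_on v oU Uu fg).
Qed.

Lemma diffn_pred k f : diffn k.+1 f -> diffn k f.
Proof. by elim: k f => [//|k IHk] f [df Df]; split=> // v; exact: IHk. Qed.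

Lemma diffn_cst k (a : R) : diffn k (fun _ => a).
Proof.
elim: k a => [//|k IHk] a; split=> [u Uu|v]; first exact: differentiable_cst.
by apply: diffn_eq (IHk 0) => u Uu; rewrite (pder_eq_cst v oU Uu (fun _ _ => erefl)).
Qed.

Lemma diffnD k f g : diffn k f -> diffn k g -> diffn k (fun u => f u + g u).
Proof.
elim: k f g => [//|k IHk] f g [df Df] [dg Dg]; split=> [u Uu|v].
  by apply: differentiableD; [exact: df|exact: dg].
by apply: diffn_eq (IHk _ _ (Df v) (Dg v)) => u Uu; rewrite pderDf; [|exact: df|exact: dg].
Qed.

Lemma diffnM k f g : diffn k f -> diffn k g -> diffn k (fun u => f u * g u).
Proof.
elim: k f g => [//|k IHk] f g fk gk; have [df Df] := fk; have [dg Dg] := gk.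
split=> [u Uu|v]; first by apply: differentiableM; [exact: df|exact: dg].
apply: diffn_eq (diffnD (IHk _ _ (diffn_pred fk) (Dg v)) (IHk _ _ (diffn_pred gk) (Df v))).
by move=> u Uu; rewrite pderMf; [|exact: df|exact: dg].
Qed.

Lemma diffn_sum k n (F : 'I_n -> 'rV[R]_m -> R) :
  (forall i, diffn k (F i)) -> diffn k (fun u => \sum_(i < n) F i u).
Proof.
elim: n F => [|n IHn] F dF.
  by apply: diffn_eq (diffn_cst k 0) => u _; rewrite big_ord0.
apply: diffn_eq (diffnD (IHn _ (fun i => dF (widen_ord (leqnSn n) i))) (dF ord_max)).
by move=> u _; rewrite big_ord_recr.
Qed.

Lemma diffnV k f : (forall u, U u -> f u != 0) -> diffn k f ->
  diffn k (fun u => (f u)^-1).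
Proof.
move=> f0; elim: k => [//|k IHk] fk; have [df Df] := fk.
have dV u : U u -> differentiable (fun u => (f u)^-1) u.
  by move=> Uu; apply: differentiableV; [exact: df|exact: f0].
split=> // v; have IH := IHk (diffn_pred fk).
apply: diffn_eq (diffnM (diffn_cst k (-1)) (diffnM (diffnM IH IH) (Df v))) => u Uu.
(* Differentiating this identity yields the derivative of the inverse. *)
have f1 y : U y -> f y * (f y)^-1 = 1 by move=> Uy; rewrite mulfV// f0.
have := pder_eq_cst v oU Uu f1; rewrite (pderMf _ (df u Uu) (dV u Uu)) => E.
apply: (mulfI (f0 u Uu)); move/eqP: E; rewrite addr_eq0 => /eqP ->.
by rewrite mulN1r mulrN !mulrA mulfV ?f0// mul1r.
Qed.

Lemma pder_id (v u : 'rV[R]_m) : pder v id u = v.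
Proof. by rewrite pderE derive_id. Qed.

Lemma diffn_coord k i : diffn k (fun u : 'rV[R]_m => u 0 i).
Proof.
case: k => [//|k]; split=> [u _|v]; first exact: differentiable_coord.
apply: diffn_eq (diffn_cst k (v 0 i)) => u Uu.
rewrite -(pder_mxE (F := id)) ?pder_id//; exact: ex_diff.
Qed.

Lemma smooth_coord n (f : 'rV[R]_m -> 'rV[R]_n) :
  (forall j k, diffn k (fun u => f u 0 j)) -> smooth_on U f.
Proof.
move=> fj k; have {}fj j : diffn k.+1 (fun u => f u 0 j) by [].
have df u : U u -> differentiable f u.
  by move=> Uu; apply: differentiable_mxP => i j; rewrite (ord1 i); exact: (fj j).1.
elim: k f fj df => [|k IHk] f fj df.
  by move=> u Uu; apply: differentiable_continuous; exact: df.
split=> // v.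
have fjv j : diffn k.+1 (fun u => ('D_v f u) 0 j).
  apply: (@diffn_eq _ (pder v (fun u => f u 0 j))); last exact: (fj j).2.
  by move=> u Uu; rewrite -pderE pder_mxE//; exact: df.
apply: IHk => // u Uu; apply: differentiable_mxP => i j; rewrite (ord1 i).
exact: (fjv j).1.
Qed.

End IteratedDifferentiability.

(** * Stereographic projection *)

Section Stereographic.
Context {R : realType} {n N : nat} (t : nat).
Context (P : 'rV[R]_N) (F : 'M[R]_(n, N)).
Context (PP : pdot t P P = 1) (FP : forall w, pdot t (w *m F) P = 0).
Context (FF : forall v w, pdot t (v *m F) (w *m F) = pdot t v w).

(** Inverse stereographic projection from [P], with [F] an isometry onto the hyperplane orthogonal
    to [P]: the line from [P] through [w *m F] meets the unit pseudosphere again at the parameter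
    [2 / (1 + pdot t w w)]. *)
Definition stereo (w : 'rV[R]_n) : 'rV[R]_N :=
  P + (2 / (1 + pdot t w w)) *: (w *m F - P).

Let q (w : 'rV[R]_n) := 1 + pdot t w w.

Lemma diffn_stereo m (U : set 'rV[R]_m) (om : 'rV[R]_m -> 'rV[R]_n) k j :
  open U -> (forall u, U u -> q (om u) != 0) ->
  (forall i, diffn U k (fun u => om u 0 i)) ->
  diffn U k (fun u => stereo (om u) 0 j).
Proof.
move=> oU q0 dom.
have dq : diffn U k (fun u => q (om u)).
  apply: (diffnD oU); first exact: (diffn_cst oU).
  apply: (diffn_eq oU (fun _ _ => esym (pdotE _ _ _))).
  apply: (diffn_sum oU) => i; apply: (diffnM oU); first exact: (diffn_cst oU).
  exact: (diffnM oU).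
have dF : diffn U k (fun u => \sum_i om u 0 i * F i j).
  by apply: (diffn_sum oU) => i; apply: (diffnM oU) => //; exact: (diffn_cst oU).
have dc a : diffn U k (fun _ => a) by exact: (diffn_cst oU).
have := diffnD oU (dc (P 0 j)) (diffnM oU (diffnM oU (dc 2) (diffnV oU q0 dq))
  (diffnD oU dF (dc (- P 0 j)))).
by apply: (diffn_eq oU) => u _; rewrite !mxE.
Qed.

Lemma stereo_subE w : q w != 0 -> q w *: (stereo w - P) = 2 *: (w *m F - P).
Proof. by move=> q0; rewrite /stereo addrC addKr scalerA mulrC divfK. Qed.

Let FPr w : pdot t P (w *m F) = 0. Proof. by rewrite pdotC FP. Qed.

Lemma stereo_sub_sqr w : q w != 0 ->
  pdot t (stereo w - P) (stereo w - P) = 4 / q w.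
Proof.
move=> q0; rewrite /stereo addrC addKr pdotZl pdotZr pdotBl !pdotBr FF FP FPr PP.
rewrite -/(q w) (_ : pdot t w w - 0 - (0 - 1) = q w); last by rewrite /q; ring.
by field.
Qed.

Lemma stereo_sub_pole w : pdot t (stereo w - P) P = - (2 / q w).
Proof. by rewrite /stereo addrC addKr pdotZl pdotBl FP PP sub0r mulrN mulr1. Qed.

Lemma stereo_unit w : q w != 0 -> pdot t (stereo w) (stereo w) = 1.
Proof.
move=> q0; have dd := stereo_sub_sqr q0; have dP := stereo_sub_pole w.
set d := stereo w - P in dd dP; have -> : stereo w = P + d by rewrite subrKC.
by clearbody d; rewrite pdotDl !pdotDr (pdotC t P d) PP dP dd; field.
Qed.

(** The product with [P] recovers [q], the chord then recovers [w *m F], and an isometry of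
    nondegenerate products is injective. *)
Lemma stereo_inj v w : q v != 0 -> q w != 0 -> stereo v = stereo w -> v = w.
Proof.
move=> qv qw vw.
have qq : q v = q w.
  have := stereo_sub_pole v; rewrite vw stereo_sub_pole => /oppr_inj /eqP.
  rewrite eqr_div// => /eqP; rewrite ![2 * _]mulrC.
  by move/(mulIf _) => -> //; rewrite pnatr_eq0.
have : v *m F = w *m F.
  apply: (addIr (- P)); apply: (scalerI (a := 2)); first by rewrite pnatr_eq0.
  by rewrite -!stereo_subE// vw qq.
move=> vFwF; apply/eqP; rewrite -subr_eq0; apply/eqP; apply: (@pdot_eq0 _ _ t) => y.
by rewrite -FF mulmxBl vFwF subrr pdot0l.
Qed.

Lemma pder_mulmxr (v w : 'rV[R]_n) : pder v (mulmx^~ F) w = v *m F.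
Proof.
have did : differentiable (id : 'rV[R]_n -> 'rV[R]_n) w by exact: ex_diff.
have dF : differentiable (mulmx^~ F : 'rV[R]_n -> 'rV[R]_N) w.
  by apply: differentiable_mulmx => //; exact: differentiable_cst.
apply/rowP => j; rewrite (pder_mxE _ _ _ dF) mxE.
rewrite (_ : (fun _ => _) = fun y : 'rV[R]_n => \sum_i F i j *: y 0 i); last first.
  by apply/funext => y; rewrite mxE; apply: eq_bigr => i _; exact: mulrC.
have dc i : differentiable (fun y : 'rV[R]_n => y 0 i) w by exact: differentiable_coord.
rewrite pder_sumf => [|i]; last by apply: differentiableZ; exact: dc.
apply: eq_bigr => i _; rewrite (pderZf _ _ (dc i)) mulrC; congr (_ * _).
by rewrite -(pder_mxE _ _ _ did) pder_id.
Qed.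

Lemma differentiable_stereo w : q w != 0 -> differentiable stereo w.
Proof.
move=> q0; have did : differentiable (id : 'rV[R]_n -> 'rV[R]_n) w by exact: ex_diff.
apply: differentiableD; first exact: differentiable_cst.
apply: differentiable_scale.
  apply: differentiableM; first exact: differentiable_cst.
  apply: differentiableV; last exact: q0.
  by apply: differentiableD; [exact: differentiable_cst|exact: differentiable_pdot].
apply: differentiableB; last exact: differentiable_cst.
by apply: differentiable_mulmx => //; exact: differentiable_cst.
Qed.

(** Obtained by differentiating [stereo_subE], in which the denominator is cleared, so that no
    quotient is differentiated. *)
Lemma pder_stereo (V : set 'rV[R]_n) v w : open V -> (forall y, V y -> q y != 0) -> V w ->
  q w *: pder v stereo w = 2 *: (v *m F) - (2 * pdot t v w) *: (stereo w - P).
Proof.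
move=> oV V0 Vw; have q0 := V0 w Vw.
have did : differentiable (id : 'rV[R]_n -> 'rV[R]_n) w by exact: ex_diff.
have dq : differentiable q w.
  by apply: differentiableD; [exact: differentiable_cst|exact: differentiable_pdot].
have dS : differentiable (fun y => stereo y + - P) w.
  by apply: differentiableD; [exact: differentiable_stereo|exact: differentiable_cst].
have dF : differentiable (mulmx^~ F : 'rV[R]_n -> 'rV[R]_N) w.
  by apply: differentiable_mulmx => //; exact: differentiable_cst.
have cP (a : 'rV[R]_N) : pder v (cst a) w = 0.
  exact: (pder_eq_cst v oV Vw (fun _ _ => erefl)).
have := pder_eq_on v oV Vw (fun y Vy => stereo_subE (V0 y Vy)).
rewrite (pder_scale _ dq dS) (pderDf _ (differentiable_stereo q0) (differentiable_cst _ _)).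
rewrite (cP (- P)) addr0 pderZf; last first.
  by apply: differentiableD; [exact: dF|exact: differentiable_cst].
rewrite (pderDf _ dF (differentiable_cst _ _)) (cP (- P)) addr0 pder_mulmxr.
have -> : pder v q w = 2 * pdot t v w.
  rewrite (pderDf _ (differentiable_cst _ _) (differentiable_pdot t did did)).
  rewrite (pder_eq_cst v oV Vw (fun _ _ => erefl)) add0r.
  by rewrite (pder_pdot t v did did) pder_id (pdotC _ w); ring.
by move=> <-; rewrite addrC addKr.
Qed.

(** The chord has square length [4 / q w], exactly what makes all terms but the one in [pdot t v v']
    cancel. *)
Lemma stereo_conformal (V : set 'rV[R]_n) v v' w :
  open V -> (forall y, V y -> q y != 0) -> V w ->
  pdot t (pder v stereo w) (pder v' stereo w) = (2 / q w) ^+ 2 * pdot t v v'.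
Proof.
move=> oV V0 Vw; have q0 := V0 w Vw.
apply: (mulfI q0); apply: (mulfI q0); rewrite mulrA.
have -> : q w * q w * pdot t (pder v stereo w) (pder v' stereo w) =
    pdot t (q w *: pder v stereo w) (q w *: pder v' stereo w).
  by rewrite pdotZl pdotZr mulrA.
rewrite !(pder_stereo _ oV V0 Vw) pdotBl !pdotBr !pdotZl !pdotZr FF stereo_sub_sqr//.
have SF y : pdot t (y *m F) (stereo w - P) = 2 / q w * pdot t y w.
  by rewrite /stereo addrC addKr pdotZr pdotBr FF FP subr0.
rewrite (pdotC _ (stereo w - P)) !SF.
by field.
Qed.

End Stereographic.

(** * Reflections of the pseudo-Euclidean space *)

Section Reflection.
Context {R : realType} {N : nat} (t : nat).
Implicit Types v x y p q : 'rV[R]_N.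

Definition reflection v x := x - (2 * pdot t x v / pdot t v v) *: v.

Lemma reflection_isometry v x y : pdot t v v != 0 ->
  pdot t (reflection v x) (reflection v y) = pdot t x y.
Proof.
move=> v0; rewrite pdotBl !pdotBr !pdotZl !pdotZr (pdotC t v y).
by field.
Qed.

Lemma reflection_id v x : pdot t x v = 0 -> reflection v x = x.
Proof. by move=> xv; rewrite /reflection xv mulr0 mul0r scale0r subr0. Qed.

(* A reflection takes q to p or to - p: reflect in p - q or in p + q, one of
   which is not isotropic. *)
Lemma exists_reflection p q : pdot t p p = 1 -> pdot t q q = 1 ->
  exists v, [/\ pdot t v v != 0, v = p + q \/ v = p - q &
    forall x, pdot t x q = 0 -> pdot t (reflection v x) p = 0].
Proof.
move=> pp qq.
have [d0|d0] := eqVneq (1 + pdot t p q) 0.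
  have dE : pdot t p q = -1 by apply/eqP; rewrite -addr_eq0 addrC d0.
  have v4 : pdot t (p - q) (p - q) = 4.
    by rewrite pdotBl !pdotBr pp qq (pdotC _ q) dE; ring.
  exists (p - q); split; [by rewrite v4 pnatr_eq0|by right|] => x xq.
  have E : reflection (p - q) q = p.
    rewrite /reflection v4 pdotBr (pdotC _ q p) qq dE.
    rewrite (_ : 2 * (-1 - 1) / 4 = -1) ?scaleN1r ?opprK ?subrKC//.
    by field.
  by rewrite -{2}E reflection_isometry// v4 pnatr_eq0.
have v2 : pdot t (p + q) (p + q) = 2 * (1 + pdot t p q).
  by rewrite pdotDl !pdotDr pp qq (pdotC _ q); ring.
have v0 : pdot t (p + q) (p + q) != 0 by rewrite v2 mulf_neq0// pnatr_eq0.
exists (p + q); split => //; first by left.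
move=> x xq; have E : reflection (p + q) q = - p.
  rewrite /reflection v2 pdotDr (pdotC _ q p) qq [_ + 1]addrC divff ?v2 -?v2//.
  by rewrite scale1r opprD addrCA subrr addr0.
by rewrite -[LHS]opprK -pdotNr -E reflection_isometry// xq oppr0.
Qed.

End Reflection.

(** * Isometric embeddings given by orthonormal rows *)

Section OrthonormalRows.
Context {R : realType} {n N : nat} (t : nat) (F : 'M[R]_(n, N)).
Context (rowsF : forall i j, pdot t (row i F) (row j F) =
                             if i == j then psign t i else 0).

Lemma pdot_orthonormal_rows v w : pdot t (v *m F) (w *m F) = pdot t v w.
Proof.
rewrite !mulmx_sum_row pdot_suml pdotE; apply: eq_bigr => i _.
rewrite pdot_sumr (bigD1 i)//= big1 ?addr0 => [|j ji].
  by rewrite pdotZl pdotZr rowsF eqxx; ring.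
by rewrite pdotZl pdotZr rowsF eq_sym (negbTE ji) !mulr0.
Qed.

Lemma pdot_rows_perp (x : 'rV[R]_N) w : (forall i, pdot t (row i F) x = 0) ->
  pdot t (w *m F) x = 0.
Proof.
move=> Fx; rewrite mulmx_sum_row pdot_suml big1// => i _.
by rewrite pdotZl Fx mulr0.
Qed.

End OrthonormalRows.

(** [P] is the antipode of [p] on M, again at height [b], and [G] is a unit vector orthogonal to [P]
    in the plane of [p] and the pole. The chart needs an orthonormal basis of the complement of [P]
    with prescribed signs, ending with [G]. Gram-Schmidt could run into null vectors, so a standard
    basis is reflected instead. *)
Lemma exists_adapted_rows {R : realType} (m t : nat) (c : R) (p : 'rV[R]_m.+2) :
  (t <= m)%N -> 1 <= c -> small_pseudosphere m t c p ->
  let b := Num.sqrt (1 - c^-1) in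
  let pole : 'rV[R]_m.+2 := delta_mx 0 ord_max in
  let P := (2 * b) *: pole - p in
  let G := Num.sqrt c *: (pole - b *: P) in
  exists F : 'M[R]_(m.+1, m.+2),
    [/\ forall i j, pdot t (row i F) (row j F) = if i == j then psign t i else 0,
        forall i, pdot t (row i F) P = 0,
        forall i, i != ord_max -> pdot t (row i F) pole = 0 &
        row ord_max F = G].
Proof.
move=> tm c1 [pp pb] b pole P G; rewrite /pseudosphere /= invr1 in pp.
have c0 : 0 < c by exact: lt_le_trans c1.
have cc : Num.sqrt c ^+ 2 = c by rewrite sqr_sqrtr// ltW.
have sc0 : Num.sqrt c != 0 by rewrite sqrtr_eq0 -ltNge.
have bb : b ^+ 2 = 1 - c^-1 := height_sqr c1.
have polex x : pdot t pole x = x 0 ord_max := pdot_pole tm x.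
have pole1 : pdot t pole pole = 1 by rewrite polex mxE !eqxx.
have polep : pdot t pole p = b by rewrite polex.
pose ph := Num.sqrt c *: (p - b *: pole).
have phph : pdot t ph ph = 1.
  rewrite pdotZl pdotZr pdotBl !pdotBr !pdotZl !pdotZr pp pole1 polep (pdotC _ p) polep.
  rewrite mulrA -expr2 cc (_ : _ - _ - _ = 1 - b ^+ 2); last by ring.
  by rewrite bb opprB addrCA subrr addr0 mulfV// gt_eqF.
have phpole : pdot t ph pole = 0.
  by rewrite pdotZl pdotBl pdotZl pole1 (pdotC _ p) polep mulr1 subrr mulr0.
pose ei (i : 'I_m.+1) : 'rV[R]_m.+2 := delta_mx 0 (widen_ord (leqnSn _) i).
have eiE i j : pdot t (ei i) (ei j) = if i == j then psign t i else 0.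
  rewrite pdot_deltal mxE eqxx /= -val_eqE /= val_eqE.
  by case: eqP => _; rewrite ?mulr1 ?mulr0.
have eipole i : pdot t (ei i) pole = 0.
  rewrite pdotC polex mxE eqxx /= -val_eqE /= eq_sym ltn_eqF ?mulr0//.
have psm : psign t m = 1 :> R by rewrite /psign ltnNge tm.
have qq : pdot t (ei ord_max) (ei ord_max) = 1 by rewrite eiE eqxx psm.
(* The reflection takes the last [ei], of positive sign because [t <= m], to [ph] or [- ph] and
   fixes the pole. The images of the other [ei] are thus orthogonal to [ph] and the pole, hence to
   [p] and [P]. *)
have [v [v0 vE vP]] := exists_reflection phph qq.
have polev : pdot t pole v = 0.
  by rewrite pdotC; case: vE => ->; [rewrite pdotDl|rewrite pdotBl];
    rewrite phpole eipole ?addr0 ?subr0.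
pose r (i : 'I_m.+1) := if i == ord_max then G else reflection t v (ei i).
have rowE' i : row i (\matrix_i r i) = r i by rewrite rowK.
have rpole i : i != ord_max -> pdot t (r i) pole = 0.
  move=> im; rewrite /r (negbTE im) -(reflection_id polev).
  by rewrite reflection_isometry// eipole.
have rp i : i != ord_max -> pdot t (r i) p = 0.
  move=> im; have -> : p = (Num.sqrt c)^-1 *: ph + b *: pole.
    by rewrite /ph scalerA mulVf// scale1r subrK.
  have rph : pdot t (r i) ph = 0.
    by rewrite /r (negbTE im); apply: vP; rewrite eiE (negbTE im).
  by rewrite pdotDr (pdotZr _ _ ph) (pdotZr _ _ pole) rph rpole// !mulr0 addr0.
have PP : pdot t P P = 1.
  rewrite pdotBl !pdotBr !pdotZl !pdotZr pp pole1 polep (pdotC _ p) polep.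
  by ring.
have poleP : pdot t pole P = b by rewrite pdotBr pdotZr pole1 polep; ring.
have GG : pdot t G G = 1.
  rewrite pdotZl pdotZr pdotBl !pdotBr !pdotZl !pdotZr PP pole1 poleP (pdotC _ P) poleP.
  rewrite mulrA -expr2 cc (_ : _ - _ - _ = 1 - b ^+ 2); last by ring.
  by rewrite bb opprB addrCA subrr addr0 mulfV// gt_eqF.
have GP : pdot t G P = 0.
  by rewrite pdotZl pdotBl pdotZl PP poleP mulr1 subrr mulr0.
have rP i : pdot t (r i) P = 0.
  have [->|im] := eqVneq i ord_max; first by rewrite /r eqxx.
  by rewrite pdotBr pdotZr rpole// rp// mulr0 subr0.
have rG i : i != ord_max -> pdot t (r i) G = 0.
  by move=> im; rewrite pdotZr pdotBr pdotZr rpole// rP mulr0 subr0 mulr0.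
exists (\matrix_i r i); split => [i j|i|i im|]; rewrite ?rowE'; last by rewrite /r eqxx.
- have [->|im] := eqVneq i ord_max.
    rewrite eq_sym; have [->|jm] := eqVneq j ord_max; first by rewrite /r eqxx GG psm.
    by rewrite {1}/r eqxx pdotC rG.
  have [->|jm] := eqVneq j ord_max.
    by rewrite (negbTE im) [r ord_max]/r eqxx rG.
  by rewrite /r (negbTE im) (negbTE jm) reflection_isometry.
- exact: rP.
exact: rpole.
Qed.

(** * A chart adapted to the small pseudosphere *)

Section AdaptedChart.
Context {R : realType} (m t : nat) (c : R) (p : 'rV[R]_m.+2).
Context (tm : (t <= m)%N) (c1 : 1 <= c) (Mp : small_pseudosphere m t c p).
Local Notation b := (Num.sqrt (1 - c^-1)).
Local Notation pole := (delta_mx 0 ord_max : 'rV[R]_m.+2).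
Local Notation P := ((2 * b) *: pole - p).
Local Notation G := (Num.sqrt c *: (pole - b *: P)).
Context (F : 'M[R]_(m.+1, m.+2)).
Context (rowsF : forall i j, pdot t (row i F) (row j F) = if i == j then psign t i else 0).
Context (rowsP : forall i, pdot t (row i F) P = 0).
Context (rows_pole : forall i, i != ord_max -> pdot t (row i F) pole = 0).
Context (row_max : row ord_max F = G).

Let c0 : 0 < c. Proof. exact: lt_le_trans c1. Qed.

Let embedding : 'M[R]_(m, m.+1) := \matrix_(i, j) (i == j :> nat)%:R.
Let emax : 'rV[R]_m.+1 := delta_mx 0 ord_max.
(** The product of [G] with the pole is the inverse of [Num.sqrt c], so this is the last coordinate
    at which the projected point has height [b]. *)
Let s := b * Num.sqrt c.

(* Stereographic projection from the point P of M maps M to the affine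
   hyperplane where the last coordinate equals s. *)
Definition adapted_theta : 'rV[R]_m.+1 -> 'rV[R]_m.+2 := stereo t P F.
Definition adapted_phi (u : 'rV[R]_m) : 'rV[R]_m.+1 := u *m embedding + s *: emax.
Definition adapted_psi (u : 'rV[R]_m) : 'rV[R]_m.+2 := adapted_theta (adapted_phi u).
(** Positivity of the denominator, rather than mere non-vanishing, makes [adapted_domain]
    star-shaped about 0. *)
Definition adapted_codomain : set 'rV[R]_m.+1 := [set w | 0 < 1 + pdot t w w].
Definition adapted_domain : set 'rV[R]_m := [set u | 0 < c + pdot t u u].
(** The factor is inverse to the conformal factor of the chart, evaluated on M. *)
Definition adapted_frame (i : 'I_m) (u : 'rV[R]_m) : 'rV[R]_m :=
  ((c + pdot t u u) / 2) *: delta_mx 0 i.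
Definition adapted_normal (u : 'rV[R]_m) : 'rV[R]_m.+1 :=
  ((c + pdot t u u) / 2) *: emax.

Local Notation theta := adapted_theta.
Local Notation phi := adapted_phi.
Local Notation psi := adapted_psi.
Local Notation W := adapted_codomain.
Local Notation U := adapted_domain.

Let cc : Num.sqrt c ^+ 2 = c. Proof. by rewrite sqr_sqrtr// ltW. Qed.
Let s_sqr : s ^+ 2 = c - 1.
Proof. by rewrite exprMn cc (height_sqr c1) mulrBl mul1r mulVf// gt_eqF. Qed.
Let psm : psign t m = 1 :> R. Proof. by rewrite /psign ltnNge tm. Qed.

Let pole1 : pdot t pole pole = 1.
Proof. by rewrite pdot_pole// mxE !eqxx. Qed.
Let polep : pdot t pole p = b.
Proof. by rewrite pdot_pole//; have [_] := Mp. Qed.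
Let pp : pdot t p p = 1.
Proof. by have [+ _] := Mp; rewrite /pseudosphere /= invr1. Qed.
Let poleP : pdot t pole P = b.
Proof. by rewrite pdotBr pdotZr pole1 polep; ring. Qed.
Let PP : pdot t P P = 1.
Proof.
rewrite pdotBl !pdotBr !pdotZl !pdotZr pp pole1 polep (pdotC _ p) polep.
by ring.
Qed.

Let FP w : pdot t (w *m F) P = 0. Proof. exact: pdot_rows_perp. Qed.
Let FF v w : pdot t (v *m F) (w *m F) = pdot t v w.
Proof. exact: pdot_orthonormal_rows. Qed.

Let embeddingE i : row i embedding = delta_mx 0 (widen_ord (leqnSn m) i).
Proof. by apply/rowP => j; rewrite !mxE eqxx /= -val_eqE /= eq_sym. Qed.

Let pdot_emax x : pdot t emax x = x 0 ord_max.
Proof. by rewrite pdot_deltal psm mul1r. Qed.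

Let embed_isometry v w : pdot t (v *m embedding) (w *m embedding) = pdot t v w.
Proof.
apply: pdot_orthonormal_rows => i j; rewrite !embeddingE pdot_deltal mxE eqxx /=.
by rewrite -val_eqE /= val_eqE; case: eqP => _; rewrite ?mulr1 ?mulr0.
Qed.

Let embed_emax v : pdot t (v *m embedding) emax = 0.
Proof.
apply: pdot_rows_perp => i; rewrite embeddingE pdotC pdot_emax mxE eqxx /=.
by rewrite -val_eqE /= gtn_eqF.
Qed.

Let phi_sqr u : 1 + pdot t (phi u) (phi u) = c + pdot t u u.
Proof.
rewrite /phi pdotDl !pdotDr !pdotZl !pdotZr embed_isometry embed_emax.
rewrite (pdotC _ emax (u *m _)) embed_emax pdot_emax mxE !eqxx mulr1 -expr2 s_sqr.
by ring.
Qed.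

Let phiW u : U u -> W (phi u).
Proof. by rewrite /adapted_codomain /= phi_sqr. Qed.

Let q0 w : W w -> 1 + pdot t w w != 0. Proof. by move/gt_eqF => ->. Qed.

Let oW : open W.
Proof.
apply: (open_comp (f := fun w : 'rV[R]_m.+1 => 1 + pdot t w w) (D := [set x | x > 0])).
  move=> w _; apply: differentiable_continuous.
  apply: differentiableD; first exact: differentiable_cst.
  by apply: differentiable_pdot; exact: ex_diff.
exact: open_gt.
Qed.

Let oU : open U.
Proof.
apply: (open_comp (f := fun u : 'rV[R]_m => c + pdot t u u) (D := [set x | x > 0])).
  move=> u _; apply: differentiable_continuous.
  apply: differentiableD; first exact: differentiable_cst.
  by apply: differentiable_pdot; exact: ex_diff.
exact: open_gt.
Qed.

Let smooth_theta : smooth_on W theta.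
Proof.
apply: (smooth_coord oW) => j k; apply: (@diffn_stereo _ _ _ t P F _ W id k j oW q0).
by move=> i; exact: (diffn_coord oW).
Qed.

Let diffn_phi i k : diffn U k (fun u => phi u 0 i).
Proof.
have dc a : diffn U k (fun _ => a) by exact: (diffn_cst oU).
have dl : diffn U k (fun u => \sum_j u 0 j * embedding j i).
  by apply: (diffn_sum oU) => j; apply: (diffnM oU) => //; exact: (diffn_coord oU).
have := diffnD oU dl (dc (s * emax 0 i)).
by apply: (diffn_eq oU) => u _; rewrite !mxE.
Qed.

Let smooth_phi : smooth_on U phi.
Proof. by apply: (smooth_coord oU) => j k; exact: diffn_phi. Qed.

Let smooth_psi : smooth_on U psi.
Proof.
apply: (smooth_coord oU) => j k; apply: (@diffn_stereo _ _ _ t P F _ U phi k j oU) => [u Uu|i].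
  exact: q0 (phiW Uu).
exact: diffn_phi.
Qed.

Let pder_phi v u : U u -> pder v phi u = v *m embedding.
Proof.
move=> Uu; have did : differentiable (id : 'rV[R]_m -> 'rV[R]_m) u by exact: ex_diff.
have dE : differentiable (mulmx^~ embedding : 'rV[R]_m -> 'rV[R]_m.+1) u.
  by apply: differentiable_mulmx => //; exact: differentiable_cst.
rewrite (pderDf _ dE (differentiable_cst (s *: emax) u)) pder_mulmxr.
by rewrite (pder_eq_cst v oU Uu (fun _ _ => erefl)) addr0.
Qed.

Let theta_conformal v w x : W x ->
  pdot t (pder v theta x) (pder w theta x) =
  (2 / (1 + pdot t x x)) ^+ 2 * pdot t v w.
Proof. by move=> Wx; exact: (stereo_conformal PP FP FF v w oW q0 Wx). Qed.

Let pder_psi v u : U u -> pder v psi u = pder (v *m embedding) theta (phi u).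
Proof.
move=> Uu; have dp := smooth_differentiable smooth_phi Uu.
have dt := smooth_differentiable smooth_theta (phiW Uu).
by apply: etrans (pder_comp v dp dt) _; rewrite pder_phi.
Qed.

Let psi_conformal v w u : U u ->
  pdot t (pder v psi u) (pder w psi u) = (2 / (c + pdot t u u)) ^+ 2 * pdot t v w.
Proof.
move=> Uu; rewrite !pder_psi// (theta_conformal _ _ (phiW Uu)) phi_sqr.
by rewrite embed_isometry.
Qed.

Let conformal_inj n k (J : 'M[R]_(n, k)) (a : R) : a != 0 ->
  (forall v w, pdot t (v *m J) (w *m J) = a ^+ 2 * pdot t v w) -> row_free J.
Proof.
move=> a0 Ja; apply: inj_row_free => v vJ; apply: (@pdot_eq0 _ _ t) => w.
have := Ja v w; rewrite vJ pdot0l => /esym/eqP.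
by rewrite mulf_eq0 expf_eq0 /= (negbTE a0) => /eqP.
Qed.

Let theta_param : local_param (pseudosphere m.+1 t 1) W theta.
Proof.
split=> //.
- by move=> v w; rewrite !inE => Wv Ww; exact: (stereo_inj PP FP FF (q0 Wv) (q0 Ww)).
- move=> _ [w Ww <-]; rewrite /pseudosphere /= invr1.
  exact: (stereo_unit PP FP FF (q0 Ww)).
move=> w Ww; have dw := smooth_differentiable smooth_theta Ww.
apply: (conformal_inj (a := 2 / (1 + pdot t w w))) => [|v v'].
  by rewrite mulf_neq0 ?invr_neq0 ?pnatr_eq0// q0.
by rewrite -!(pder_jacobian _ dw) theta_conformal.
Qed.

Let psi_small : psi @` U `<=` small_pseudosphere m t c.
Proof.
move=> _ [u Uu <-]; split.
  by have [_ _ _ + _] := theta_param; apply; exists (phi u) => //; exact: phiW.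
rewrite /= -(pdot_pole tm) /adapted_psi /adapted_theta /stereo pdotDr poleP pdotZr pdotBr poleP.
rewrite phi_sqr mulmxDl pdotDr (pdotC _ _ (_ *m F)) -mulmxA.
have -> : pdot t (u *m (embedding *m F)) pole = 0.
  rewrite mulmxA mulmx_sum_row pdot_suml big1// => j _; rewrite pdotZl.
  have [->|jm] := eqVneq j ord_max; last by rewrite rows_pole ?mulr0.
  by rewrite -(pdot_emax (u *m embedding)) pdotC embed_emax mul0r.
rewrite -scalemxAl -rowE row_max pdotZr pdotZr pdotBr pdotZr pole1 poleP.
(* Only the last row of [F] meets the pole; the value of [s] reduces its contribution to
   [b * (c * c^-1)], which cancels the height of [P]. *)
rewrite (_ : s * _ = b * (Num.sqrt c ^+ 2 * (1 - b ^+ 2))); last by rewrite /s; ring.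
rewrite cc (height_sqr c1) subKr mulfV ?gt_eqF//.
by rewrite mulr1 add0r subrr mulr0 addr0.
Qed.

(** Projecting from the antipode of [p] centres the chart at [p], which later places its image in
    the component of [p]. *)
Let psi0 : psi 0 = p.
Proof.
rewrite /adapted_psi /adapted_theta /stereo phi_sqr pdot0l addr0 /adapted_phi mul0mx add0r.
rewrite -scalemxAl -rowE row_max scalerA -mulrA -expr2 cc.
have bb : b * b = 1 - c^-1 by rewrite -expr2 (height_sqr c1).
apply/rowP => j; rewrite !mxE; move: (_ == _)%:R (p 0 j) bb => x y.
move: (Num.sqrt _) => a aa.
(* Here [a] is [b], while [x] and [y] are entries of the pole and of [p]; the relation on [a] turns
   [a * a * c + 1] into [c]. *)
transitivity (2 * a * x - y + 2 / c * (a * c * x - (a * a * c + 1) * (2 * a * x - y))).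
  by ring.
by rewrite aa; field; rewrite gt_eqF.
Qed.

(** Scaling multiplies the square length of [u] by a number in [0, 1]: a negative value increases,
    and a nonnegative one stays nonnegative. *)
Let star_shaped u (r : R) : U u -> 0 <= r <= 1 -> U (r *: u).
Proof.
rewrite /adapted_domain /= pdotZl pdotZr mulrA => Uu /andP[r0 r1].
have rr : 0 <= r * r <= 1 by rewrite mulr_ge0// mulr_ile1.
have [u0|u0] := leP 0 (pdot t u u).
  by rewrite ltr_wpDr// mulr_ge0// (andP rr).1.
by apply: lt_le_trans Uu _; rewrite lerD2l ler_nMl// (andP rr).2.
Qed.

(** The image of the segment from 0 to [u] is connected, stays in the small pseudosphere and joins
    [p] to [psi u]. *)
Let psi_component : psi @` U `<=` connected_component (small_pseudosphere m t c) p.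
Proof.
move=> _ [u Uu <-].
pose seg : set R := `[0, 1]%classic.
have segU r : seg r -> U (r *: u).
  by rewrite /seg /= in_itv /=; exact: star_shaped.
apply: (@connected_component_max _ _ ((fun r : R => psi (r *: u)) @` seg)).
- by exists 0; [rewrite /seg /= in_itv /= lexx ler01|rewrite scale0r psi0].
- by move=> _ [r sr <-]; apply: psi_small; exists (r *: u) => //; exact: segU.
- apply: connected_continuous_connected; first exact: segment_connected.
  apply: continuous_in_subspaceT => r; rewrite inE => /segU Ur.
  apply: (@continuous_comp _ _ _ (fun r : R => r *: u) psi).
    exact: scalel_continuous.
  exact: smooth_continuous smooth_psi Ur.
by exists 1; [rewrite /seg /= in_itv /= lexx ler01|rewrite scale1r].
Qed.

Let psi_param :
  local_param (connected_component (small_pseudosphere m t c) p) U psi.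
Proof.
split=> //.
- move=> u v; rewrite !inE => Uu Uv uv.
  have := stereo_inj PP FP FF (q0 (phiW Uu)) (q0 (phiW Uv)) uv.
  move/addIr => E; apply/eqP; rewrite -subr_eq0; apply/eqP.
  apply: (@pdot_eq0 _ _ t) => w.
  by rewrite -embed_isometry mulmxBl E subrr pdot0l.
move=> u Uu; have du := smooth_differentiable smooth_psi Uu.
apply: (conformal_inj (a := 2 / (c + pdot t u u))) => [|v v'].
  by rewrite mulf_neq0 ?invr_neq0 ?pnatr_eq0// gt_eqF.
by rewrite -!(pder_jacobian _ du) psi_conformal.
Qed.

Lemma adapted_inclusion :
  local_inclusion (connected_component (small_pseudosphere m t c) p)
    (pseudosphere m.+1 t 1) U psi W theta phi.
Proof.
split; [exact: psi_param|exact: theta_param|exact: smooth_phi| |by []].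
by move=> _ [u Uu <-]; exact: phiW.
Qed.

Let diffn_factor k : diffn U k (fun u => (c + pdot t u u) / 2).
Proof.
have dc a : diffn U k (fun _ => a) by exact: (diffn_cst oU).
apply: (diffnM oU) => //; apply: (diffnD oU) => //.
apply: (diffn_eq oU (fun _ _ => esym (pdotE _ _ _))).
apply: (diffn_sum oU) => i; apply: (diffnM oU) => //.
by apply: (diffnM oU); exact: (diffn_coord oU).
Qed.

Let smooth_factor n (v : 'rV[R]_n) : smooth_on U (fun u => ((c + pdot t u u) / 2) *: v).
Proof.
apply: (smooth_coord oU) => j k.
have := diffnM oU (diffn_factor k) (diffn_cst oU k (v 0 j)).
by apply: (diffn_eq oU) => u _; rewrite mxE.
Qed.

Lemma adapted_orthonormal_frame :
  orthonormal_frame (induced_metric t psi) U adapted_frame (psign t).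
Proof.
split=> [i|i|u Uu i j]; first exact: smooth_factor.
  by rewrite /psign; case: ifP => _; [right|left].
rewrite (mdot_induced t smooth_psi _ _ Uu) psi_conformal// pdotZl pdotZr pdot_deltal.
rewrite mxE eqxx /= eq_sym; have [->|ij] := eqVneq i j; last by rewrite !mulr0.
by rewrite mulr1; field; rewrite gt_eqF.
Qed.

Lemma adapted_unit_normal :
  unit_normal (induced_metric t theta) U phi adapted_normal 1.
Proof.
split=> [||u Uu|u Uu X]; first exact: smooth_factor; first by left.
all: rewrite (mdot_induced t smooth_theta _ _ (phiW Uu)) (theta_conformal _ _ (phiW Uu)).
  rewrite phi_sqr pdotZl pdotZr pdot_emax mxE !eqxx mulr1.
  by field; rewrite gt_eqF.
by rewrite -pderE pder_phi// pdotZl (pdotC _ emax) embed_emax !mulr0.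
Qed.

Lemma adapted_domain0 : U 0.
Proof. by rewrite /adapted_domain /= pdot0l addr0. Qed.

End AdaptedChart.

(** * Characterization of proper r-harmonicity *)

Unset Implicit Arguments.

Theorem corollary3p10 (R : realType) (r m t : nat) (c : R) (p : 'rV[R]_m.+2)
  (hr : (3 <= r)%N) (hm : (2 <= m)%N) (ht : (1 <= t <= m)%N) (hc : 1 <= c)
  (hp : small_pseudosphere m t c p) :
  proper_r_harmonic m t r
    (connected_component (small_pseudosphere m t c) p)
    (pseudosphere m.+1 t 1)
  <-> c = r%:R.
Proof.
have tm : (t <= m)%N by case/andP: ht.
have m0 : (0 < m)%N by exact: ltnW.
have [F [rF rP rpole rmax]] := exists_adapted_rows tm hc hp.
have MS := @connected_component_sub _ (small_pseudosphere m t c) p.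
have incl0 := adapted_inclusion tm hc hp rF rP rpole rmax.
have U0 : adapted_domain t c (0 : 'rV[R]_m) by exact: adapted_domain0.
have frame0 := adapted_orthonormal_frame tm hc hp rF rP.
have normal0 := adapted_unit_normal tm hc hp rF rP.
have c0 : 0 < c by exact: lt_le_trans hc.
have bb := height_sqr hc.
have coefE : m%:R * Num.sqrt (1 - c^-1) ^+ 2 * c - m%:R * (r.-1)%:R = m%:R * (c - r%:R).
  have -> : r%:R = r.-1%:R + 1 :> R by rewrite natr1 prednK// (leq_trans _ hr).
  by rewrite bb; field; rewrite gt_eqF.
split=> [[harm nmin]|cr].
  (* Properness enters here: for [b = 0] the mean curvature would vanish in every chart. *)
  have bn0 : Num.sqrt (1 - c^-1) != 0.
    apply/eqP => b0; apply: nmin => U psi W theta phi incl eta eps A nrm shp u Uu.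
    by rewrite (mean_curvature_scalar hc tm MS incl nrm m0 shp Uu) b0 mulr0.
  have := harm _ _ _ _ _ incl0 _ _ frame0 0 U0.
  rewrite (r_tension_normal hc tm MS incl0 frame0 hr U0) coefE => /eqP.
  rewrite scaler_eq0 (negbTE (normal_field_neq0 hc tm MS incl0 U0)) orbF.
  have mR0 : m%:R != 0 :> R by rewrite pnatr_eq0 -lt0n.
  have cn0 : c != 0 by rewrite gt_eqF.
  (* The other factor, [mu * lam ^+ (r - 2)], is a product of powers of the nonzero numbers [m], [b]
     and [c]. *)
  rewrite mulrA mulf_eq0 subr_eq0 => /orP[|/eqP //].
  by apply: contraTeq => _; rewrite ?(mulf_neq0, expf_neq0).
split=> [U psi W theta phi incl e eps frame u Uu|min].
  rewrite (r_tension_normal hc tm MS incl frame hr Uu) coefE cr subrr.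
  by rewrite !mulr0 scale0r.
(* Minimality in the adapted chart would force [b = 0], hence [c <= 1], against [c = r] and
   [r >= 3]. *)
have shp := shape_operator_scalar hc tm MS incl0 normal0.
have := min _ _ _ _ _ incl0 _ _ _ normal0 shp 0 U0.
rewrite (mean_curvature_scalar hc tm MS incl0 normal0 m0 shp U0) mul1r => /eqP.
rewrite mulf_eq0 (negbTE (normal_factor_neq0 hc tm MS incl0 normal0 U0)) /=.
by rewrite sqrtr_eq0 subr_le0 invf_ge1// cr lern1 leqNgt (leq_trans _ hr).
Qed.
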